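(* Let $\alpha\in(0,2]$. There exist a constant $C(\alpha)>0$ depending only on $\alpha$ and an absolute constant $C>0$ such that the following holds. Let $\lambda>0$ and let $A\in\mathbb{R}^{m\times n}$ be a random matrix whose columns $A_i$ are independent, mean-zero random vectors in $\mathbb{R}^m$. Assume that $\|A_i\|_2=\lambda$ almost surely for every $i$ and that the columns have $\psi_\alpha$-norm (quasi-norm when $\alpha<1$) bounded by $K$. Let $T\subset\mathbb{R}^n$ be a bounded set. Then $$\mathbb{E}\sup_{x\in T}\Bigl|\|Ax\|_2-\lambda\|x\|_2\Bigr|\le C(\alpha)K\bigl(\gamma_\alpha(T)+\mathrm{rad}(T)\bigr).$$ Moreover, for any $u\ge0$, with probability at least $1-Ce^{-u^\alpha}$, $$\sup_{x\in T}\Bigl|\|Ax\|_2-\lambda\|x\|_2\Bigr|\le C(\alpha)K\bigl(\gamma_\alpha(T)+u\cdot\mathrm{rad}(T)\bigr).$$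
   Context: For a real random variable $\xi$ and $\alpha>0$, $\|\xi\|_{\psi_\alpha}:=\inf\{t>0:\mathbb{E}\exp(|\xi/t|^\alpha)\le 2\}$. For a random vector $\xi$ in $\mathbb{R}^m$, $\|\xi\|_{\psi_\alpha}:=\sup_{x\in S^{m-1}}\|\langle\xi,x\rangle\|_{\psi_\alpha}$. $\mathrm{rad}(T):=\sup_{t\in T}\|t\|_2$. Talagrand's functional: an admissible sequence of partitions of $T$ is an increasing sequence $(\mathcal{A}_k)_{k\ge0}$ of partitions of $T$ (each $\mathcal{A}_{k+1}$ refines $\mathcal{A}_k$) with $|\mathcal{A}_0|=1$ and $|\mathcal{A}_k|\le 2^{2^k}$ for $k\ge1$. For $t\in T$, $A_k(t)$ is the unique element of $\mathcal{A}_k$ containing $t$. Then $$\gamma_\alpha(T):=\inf\sup_{t\in T}\sum_{k\ge0}2^{k/\alpha}\Delta(A_k(t)),$$ where the infimum is over all admissible sequences and $\Delta(S)=\sup_{s,t\in S}\|s-t\|_2$ is the Euclidean diameter. *)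

(* Defs.v *)
From mathcomp Require Export all_boot all_order all_algebra.
From mathcomp Require Export all_classical all_reals all_analysis.

Set Implicit Arguments.
Unset Strict Implicit.
Unset Printing Implicit Defensive.
Import Order.TTheory GRing.Theory Num.Theory.
Import numFieldNormedType.Exports.

Local Open Scope classical_set_scope.
Local Open Scope ring_scope.

Section euclidean.
Context {R : realType} {n : nat}.
Implicit Types (x y : 'cV[R]_n) (S T : set 'cV[R]_n).

Definition dotv x y : R := \sum_(i < n) x i 0 * y i 0.

(* The library norm on ['cV[R]_n] is the sup norm; this is the Euclidean one. *)
Definition l2norm x : R := Num.sqrt (dotv x x).

Definition unit_sphere : set 'cV[R]_n := [set x | l2norm x = 1].

Definition l2bounded T := exists M : R, forall x, T x -> l2norm x <= M.

(* Suprema are taken in [\bar R]; the supremum of the empty set is [-oo]. *)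
Definition rad T : \bar R := ereal_sup [set (l2norm t)%:E | t in T].

Definition l2diam S : \bar R :=
  ereal_sup [set (l2norm (st.1 - st.2))%:E | st in S `*` S].

End euclidean.

Section talagrand.
Context {R : realType} {n : nat}.
Implicit Types (T : set 'cV[R]_n) (A : nat -> set (set 'cV[R]_n)).

(* [partition (A k) id T]: the members of [A k] are nonempty, pairwise
   disjoint, and their union is [T]. *)
Definition admissible T A :=
  [/\ forall k, partition (A k) id T,
      forall k B, A k.+1 B -> exists2 B', A k B' & B `<=` B',
      (A 0%N #= `I_1)%card
    & forall k, (1 <= k)%N -> (A k #<= `I_(2 ^ (2 ^ k))%N)%card].

Definition talagrand_gamma (alpha : R) T : \bar R :=
  ereal_inf [set ereal_sup
      [set (\sum_(0 <= k <oo) (2 `^ (k%:R / alpha))%:E *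
              l2diam (pblock (A k) id t))%E | t in T]
    | A in admissible T].

End talagrand.

(* Borel sigma-algebra, generated by the open sets. *)
Definition borel (V : ptopologicalType) := g_sigma_algebraType (@open V).

Section random.
Context {d : measure_display} {Om : measurableType d} {R : realType}.
Variable P : probability Om R.

Definition random_matrix {m n : nat} (A : Om -> 'M[R]_(m, n)) :=
  measurable_fun [set: Om] (A : Om -> borel 'M[R]_(m, n)).

Definition mutually_independent {I : finType} {V : ptopologicalType}
    (X : I -> Om -> V) :=
  forall (J : {set I}) (B : I -> set (borel V)),
    (forall i, i \in J -> measurable (B i)) ->
    P (\bigcap_(i in [set` J]) X i @^-1` B i)
      = (\prod_(i in J) P (X i @^-1` B i))%E.

(* The infimum of the empty set is [+oo]. *)
Definition psi_norm (alpha : R) (xi : Om -> R) : \bar R :=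
  ereal_inf [set t%:E | t in
    [set t : R | 0 < t /\
       ('E_P[fun w => expR (`|xi w / t| `^ alpha)%R] <= 2%:E)%E]].

Definition psi_normv {m : nat} (alpha : R) (xi : Om -> 'cV[R]_m) : \bar R :=
  ereal_sup [set psi_norm alpha (fun w => dotv (xi w) x) | x in unit_sphere].

End random.

Definition deviation {R : realType} {m n : nat} (lambda : R)
    (T : set 'cV[R]_n) (M : 'M[R]_(m, n)) : \bar R :=
  ereal_sup [set `|l2norm (M *m x) - lambda * l2norm x|%:E | x in T].

(* Main.v *)
Require Import Defs.
From mathcomp Require Import measurable_realfun ring lra zify.
Set Implicit Arguments.
Unset Strict Implicit.
Unset Printing Implicit Defensive.
Import Order.TTheory GRing.Theory Num.Theory.
Import numFieldNormedType.Exports.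
Local Open Scope classical_set_scope.
Local Open Scope ring_scope.

(** The process [Z x = |A x| - lam |x|] has increments whose moments of order
    [p = 2 ^ l] are at most [(C K p^(1/alpha) |x - y|)^p]; generic chaining then
    gives both bounds.  Only these dyadic moments are used, so that the weights
    [2 ^ (k / alpha)] of [gamma_alpha] are exactly the growth rates of the
    moments.

    Moments.  For fixed [v], [<A u, v>] is a sum of independent centred
    variables; truncated exponential series show that its [p]-th moment is of
    order [(K p^(1/alpha) |u| |v|)^p], the hypothesis [alpha <= 2] entering
    through [j^(j/alpha) <= j^(j/2) p^(j(1/alpha - 1/2))] for [j <= p].
    Splitting the columns at random into two halves decouples the off-diagonal
    part of [<A u, A v>], which costs a factor 4 and reduces it to such linear
    forms with [v] replaced by an independent [A v].  As
    [|A v|^2 = lam^2 |v|^2 + offdiag], the moments of [|A v|] are then bounded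
    by induction on [l], and the increments through
      [lam (|x| + |y|) (Z x - Z y)
         = offdiag (x - y) (x + y) - (Z x + Z y) (|A x| - |A y|)].

    All functions of [A] whose expectation is taken are bounded once the columns
    have been modified on a null set to have norm exactly [lam], and they are
    combinations of products of functions of single columns; this replaces
    conditioning. *)

(** * Bounded random variables *)

(** For [alpha < 1] no exponential moment of [<A u, v>] is controlled by [K]: the psi bound looks
    subgaussian only up to a given order. Hence truncated series, run anew for each order [2 ^ l]
    with a scale [La l] of its own.

    Bounding [|A x| - |A y|] by [|A (x - y)|] costs a multiple of [lam |x - y|], which is affordable
    only when [La l >= lam]. When [La l <= lam], the displayed identity gains what is missing: each
    term on its right has one factor of order [La l] and one of order [lam], and division by
    [lam (|x| + |y|)] removes the second. The estimates of [Z] and of its increments therefore split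
    on the comparison of [La l] with [lam].

    The chain leaves [0] for a level [l0] that is free. Failure then has probability of order
    [exp (- 2 ^ l0)] and the first link costs a multiple of [2 ^ (l0 / alpha) rad T]. Taking
    [2 ^ l0] between [u ^ alpha] and [2 u ^ alpha] gives the tail bound; summing over [l0] gives the
    expectation. *)

Section bounded_measurable.
Context {d : measure_display} {T : measurableType d} {R : realType}.
Implicit Types (f g : T -> R).

Definition bmf f := measurable_fun setT f /\ exists M : R, forall x, `|f x| <= M.

Lemma bmf_cst (c : R) : bmf (fun=> c).
Proof. by split; [exact: measurable_cst | exists `|c|]. Qed.

Lemma bmfD f g : bmf f -> bmf g -> bmf (fun x => f x + g x).
Proof.
move=> [mf [M fM]] [mg [N gN]]; split; first exact: measurable_funD.
by exists (M + N) => x; rewrite (le_trans (ler_normD _ _))// lerD.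
Qed.

Lemma bmfM f g : bmf f -> bmf g -> bmf (fun x => f x * g x).
Proof.
move=> [mf [M fM]] [mg [N gN]]; split; first exact: measurable_funM.
by exists (M * N) => x; rewrite normrM ler_pM.
Qed.

Lemma bmfN f : bmf f -> bmf (fun x => - f x).
Proof.
by move=> [mf [M fM]]; split; [exact: measurable_funN | exists M => x; rewrite normrN].
Qed.

Lemma bmfB f g : bmf f -> bmf g -> bmf (fun x => f x - g x).
Proof. by move=> bf bg; apply: bmfD => //; exact: bmfN. Qed.

Lemma bmfZ (c : R) f : bmf f -> bmf (fun x => c * f x).
Proof. by move=> bf; apply: bmfM => //; exact: bmf_cst. Qed.

Lemma bmf_norm f : bmf f -> bmf (fun x => `|f x|).
Proof.
move=> [mf [M fM]]; split; first exact: measurableT_comp.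
by exists M => x; rewrite normr_id.
Qed.

Lemma bmfX f k : bmf f -> bmf (fun x => f x ^+ k).
Proof.
move=> [mf [M fM]]; split; first exact: measurable_funX.
by exists (M ^+ k) => x; rewrite normrX lerXn2r// nnegrE (le_trans _ (fM x)).
Qed.

Lemma bmf_sum (I : Type) (r : seq I) (Q : pred I) (F : I -> T -> R) :
  (forall i, Q i -> bmf (F i)) -> bmf (fun x => \sum_(i <- r | Q i) F i x).
Proof.
move=> bF; elim: r => [|i r ih].
  have -> : (fun x => \sum_(i <- [::] | Q i) F i x) = fun=> 0; last exact: bmf_cst.
  by apply/funext => x; rewrite big_nil.
rewrite (_ : (fun x => \sum_(j <- i :: r | Q j) F j x) =
    fun x => (if Q i then F i x else 0) + \sum_(j <- r | Q j) F j x).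
  by apply: bmfD => //; case: (Q i) (bF i) => [/(_ isT)//|_]; exact: bmf_cst.
by apply/funext => x; rewrite big_cons; case: ifP => // _; rewrite add0r.
Qed.

Lemma bmf_prod (I : Type) (r : seq I) (Q : pred I) (F : I -> T -> R) :
  (forall i, Q i -> bmf (F i)) -> bmf (fun x => \prod_(i <- r | Q i) F i x).
Proof.
move=> bF; elim: r => [|i r ih].
  have -> : (fun x => \prod_(i <- [::] | Q i) F i x) = fun=> 1; last exact: bmf_cst.
  by apply/funext => x; rewrite big_nil.
rewrite (_ : (fun x => \prod_(j <- i :: r | Q j) F j x) =
    fun x => (if Q i then F i x else 1) * \prod_(j <- r | Q j) F j x).
  by apply: bmfM => //; case: (Q i) (bF i) => [/(_ isT)//|_]; exact: bmf_cst.
by apply/funext => x; rewrite big_cons; case: ifP => // _; rewrite mul1r.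
Qed.

Lemma bmf_sqrt f : bmf f -> bmf (fun x => Num.sqrt (f x)).
Proof.
move=> [mf [M fM]]; split.
  apply: measurableT_comp => //; apply: continuous_measurable_fun.
  exact: sqrt_continuous.
exists (Num.sqrt M) => x; rewrite ger0_norm ?sqrtr_ge0//.
by apply: ler_wsqrtr; rewrite (le_trans (ler_norm _)).
Qed.

Lemma bmf_indic (A : set T) : measurable A -> bmf (\1_A : T -> R).
Proof.
move=> mA; split; first exact: measurable_indic.
by exists 1 => x; rewrite ger0_norm// indicE lern1 leq_b1.
Qed.

End bounded_measurable.

Section expectation.
Context {d : measure_display} {Om : measurableType d} {R : realType}.
Variable P : probability Om R.
Implicit Types (f g : Om -> R).

Definition Ex f : R := \int[P]_w f w.

Lemma bmf_integrable f : bmf f -> P.-integrable setT (EFin \o f).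
Proof.
move=> [mf [M fM]]; apply: measurable_bounded_integrable => //.
  by rewrite ltey_eq fin_num_measure.
by exists M; split; [exact: num_real | move=> N MN w _ /=; rewrite (le_trans (fM w))// ltW].
Qed.

Lemma Ex_EFin f : bmf f -> (Ex f)%:E = (\int[P]_w (f w)%:E)%E.
Proof.
move=> bf; rewrite /Ex /Rintegral fineK//.
by apply: integrable_fin_num => //; exact: bmf_integrable.
Qed.

Lemma Ex_cst (c : R) : Ex (fun=> c) = c.
Proof.
rewrite /Ex Rintegral_cst// [X in fine X](_ : _ = 1%E) ?mulr1//.
exact: probability_setT.
Qed.

Lemma ExD f g : bmf f -> bmf g -> Ex (fun w => f w + g w) = Ex f + Ex g.
Proof. by move=> bf bg; rewrite /Ex RintegralD//; exact: bmf_integrable. Qed.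

Lemma ExB f g : bmf f -> bmf g -> Ex (fun w => f w - g w) = Ex f - Ex g.
Proof. by move=> bf bg; rewrite /Ex RintegralB//; exact: bmf_integrable. Qed.

Lemma ExZ (c : R) f : bmf f -> Ex (fun w => c * f w) = c * Ex f.
Proof. by move=> bf; rewrite /Ex RintegralZl//; exact: bmf_integrable. Qed.

Lemma ExZr (c : R) f : bmf f -> Ex (fun w => f w * c) = Ex f * c.
Proof. by move=> bf; rewrite /Ex RintegralZr//; exact: bmf_integrable. Qed.

Lemma Ex_le f g : bmf f -> bmf g -> (forall w, f w <= g w) -> Ex f <= Ex g.
Proof. by move=> bf bg fg; apply: le_Rintegral => //; exact: bmf_integrable. Qed.

Lemma Ex_ge0 f : (forall w, 0 <= f w) -> 0 <= Ex f.
Proof. by move=> f0; apply: Rintegral_ge0. Qed.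

Lemma Ex_norm f : bmf f -> `|Ex f| <= Ex (fun w => `|f w|).
Proof. by move=> bf; apply: le_normr_Rintegral => //; exact: bmf_integrable. Qed.

Lemma Ex_sum (I : Type) (r : seq I) (Q : pred I) (F : I -> Om -> R) :
  (forall i, Q i -> bmf (F i)) ->
  Ex (fun w => \sum_(i <- r | Q i) F i w) = \sum_(i <- r | Q i) Ex (F i).
Proof.
move=> bF; elim: r => [|i r ih].
  by rewrite big_nil -[RHS]Ex_cst; congr (Ex _); apply/funext => w; rewrite big_nil.
rewrite big_cons -ih; case: ifPn => Qi; last first.
  by congr (Ex _); apply/funext => w; rewrite big_cons (negPf Qi).
rewrite -ExD//; [|exact: bF|exact: bmf_sum].
by congr (Ex _); apply/funext => w; rewrite big_cons Qi.
Qed.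

Lemma Ex_indic (A : set Om) : measurable A -> (Ex \1_A)%:E = P A.
Proof. by move=> mA; rewrite Ex_EFin ?integral_indic ?setIT//; exact: bmf_indic. Qed.

End expectation.

(** * Independence: product formula and partial expectations *)

Section orthogonality.
Context {d d' : measure_display} {Om : measurableType d} {T : measurableType d'}.
Context {R : realType}.
Variable P : probability Om R.

(** The expectation is linear in [g] and continuous for uniform convergence along [Y], and a bounded
    measurable [g] is a uniform limit of combinations of indicators. This leads from the events in
    the definition of independence to functions. *)
Lemma Ex_orthogonal (Y : Om -> T) (Z : Om -> R) (g : T -> R) (M : R) :
  measurable_fun setT Y -> bmf Z -> measurable_fun setT g ->
  (forall w, `|g (Y w)| <= M) ->
  (forall B, measurable B -> Ex P (fun w => \1_B (Y w) * Z w) = 0) ->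
  Ex P (fun w => g (Y w) * Z w) = 0.
Proof.
move=> mY bZ mg gM orth.
have bgY : bmf (fun w => g (Y w)) by split; [exact: measurableT_comp|exists M].
have bI B : measurable B -> bmf (fun w => \1_B (Y w) : R).
  move=> mB; have [mi [N iN]] := @bmf_indic _ _ R _ mB.
  by split; [exact: measurableT_comp|exists N].
apply/eqP; rewrite -normr_le0 leNgt; apply/negP => E0.
set c := Ex P (fun w => `|Z w|).
have c0 : 0 <= c by apply: Ex_ge0.
(* [N] exceeds [c + 1] divided by the supposedly nonzero value, so that an approximation error
   [c / N] is already smaller than that value. *)
pose N := (Num.truncn ((c + 1) / `|Ex P (fun w => g (Y w) * Z w)|)).+1.
have N0 : 0 < N%:R :> R by rewrite ltr0n.
have N0' : N%:R != 0 :> R by rewrite gt_eqF.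
(* Approximates [g] uniformly within [1 / N] by its values rounded on the grid [k / N - M]. *)
pose h w : nat := Num.truncn (N%:R * (g (Y w) + M)).
have gM0 w : 0 <= N%:R * (g (Y w) + M).
  by rewrite mulr_ge0// -lerBlDr sub0r; have := gM w; rewrite ler_norml => /andP[].
pose K := (Num.truncn (N%:R * (M + M))).+1.
have hK w : (h w < K)%N.
  rewrite ltnS; apply: le_truncn; rewrite ler_wpM2l ?ler0n// lerD2r.
  exact: le_trans (ler_norm _) (gM w).
pose B k : set T := g @^-1` [set` `[k%:R / N%:R - M, (k%:R + 1) / N%:R - M[].
have mB k : measurable (B k) by rewrite -[B k]setTI; exact: mg.
have BE k w : (Y w \in B k) = (h w == k).
  rewrite /B; apply/idP/idP.
    rewrite inE /= in_itv/= => /andP[l r]; apply/eqP; rewrite /h.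
    apply: truncn_def; rewrite -natr1 [_ * (_ + _)]mulrC.
    by move: l r; rewrite lerBlDr ltrBrDr ler_pdivrMr// ltr_pdivlMr// => -> ->.
  move/eqP => <-; rewrite inE/= in_itv/=.
  have /truncn_itv := gM0 w; rewrite -/(h w) -natr1 [_ * (_ + _)]mulrC => /andP[l r].
  by rewrite lerBlDr ltrBrDr ler_pdivrMr// ltr_pdivlMr// l r.
pose G w : R := \sum_(k < K) (k%:R / N%:R - M) * \1_(B k) (Y w).
have GE w : G w = (h w)%:R / N%:R - M.
  rewrite /G (bigD1 (Ordinal (hK w)))//= big1 ?addr0 => [|k /eqP kh].
    by rewrite indicE BE eqxx mulr1.
  rewrite indicE BE; case: eqP; rewrite ?mulr0// => hk.
  by exfalso; apply: kh; exact: val_inj.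
have bG : bmf G by apply: bmf_sum => k _; apply: bmfZ; exact: bI.
have EG : Ex P (fun w => G w * Z w) = 0.
  rewrite (_ : (fun w => _) =
      (fun w => \sum_(k < K) (k%:R / N%:R - M) * (\1_(B k) (Y w) * Z w))); last first.
    by apply/funext => w; rewrite mulr_suml; apply: eq_bigr => k _; rewrite mulrA.
  rewrite Ex_sum => [|k _]; last by apply/bmfZ/bmfM => //; exact: bI.
  by rewrite big1// => k _; rewrite ExZ ?orth ?mulr0//; apply: bmfM => //; exact: bI.
have gG w : `|g (Y w) - G w| <= N%:R^-1.
  have /truncn_itv := gM0 w; rewrite -/(h w) -natr1 => /andP[l r].
  rewrite GE (_ : _ - _ = (N%:R * (g (Y w) + M) - (h w)%:R) / N%:R); last by field.
  rewrite normrM [`|_^-1|]gtr0_norm ?invr_gt0// ler_piMl ?invr_ge0 ?ler0n//.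
  by rewrite ger0_norm ?subr_ge0// lerBlDl ltW// addrC.
have : `|Ex P (fun w => g (Y w) * Z w)| <= N%:R^-1 * c.
  rewrite -[X in `|X|]subr0 -EG -ExB; [|exact: bmfM|exact: bmfM].
  rewrite /c -ExZ; last exact: bmf_norm.
  apply: le_trans (Ex_norm _ _) _; first by apply: bmfB; exact: bmfM.
  apply: Ex_le; [by apply/bmf_norm/bmfB; exact: bmfM|exact/bmfZ/bmf_norm|].
  by move=> w; rewrite -mulrBl normrM ler_wpM2r.
rewrite -(ler_pM2l N0) mulrA divff// mul1r leNgt => /negP; apply.
rewrite (lt_trans (_ : c < c + 1))// ?ltrDl// -ltr_pdivrMr// /N.
by have /truncn_itv/andP[] : 0 <= (c + 1) / `|Ex P (fun w => g (Y w) * Z w)|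
  by rewrite divr_ge0// addr_ge0.
Qed.

End orthogonality.

Section product_formula.
Context {d : measure_display} {Om : measurableType d} {R : realType}.
Variable P : probability Om R.
Context {I : finType} {V : ptopologicalType}.
Variable Y : I -> Om -> V.
Hypothesis mY : forall i, measurable_fun setT (Y i : Om -> borel V).
Hypothesis iY : mutually_independent P Y.

(** Boundedness is asked only along [Y i]: the coordinates of a vector are unbounded functions, yet
    bounded on columns of fixed norm. *)
Definition test_fun i (g : V -> R) :=
  measurable_fun setT (g : borel V -> R) /\ exists M, forall w, `|g (Y i w)| <= M.

Lemma test_fun_bmf i g : test_fun i g -> bmf (fun w => g (Y i w)).
Proof. by move=> [mg bg]; split => //; exact: measurableT_comp (mY i). Qed.

Lemma test_fun_cst i (c : R) : test_fun i (fun=> c).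
Proof. by split; [exact: measurable_cst|exists `|c|]. Qed.

Lemma test_funM i g h : test_fun i g -> test_fun i h -> test_fun i (fun v => g v * h v).
Proof.
move=> [mg [M gM]] [mh [N hN]]; split; first exact: measurable_funM.
by exists (M * N) => w; rewrite normrM ler_pM.
Qed.

Lemma test_fun_indic i (B : set (borel V)) : measurable B -> test_fun i (\1_B).
Proof.
move=> mB; split; first exact: measurable_indic.
by exists 1 => w; rewrite ger0_norm// indicE lern1 leq_b1.
Qed.

Lemma Ex_prod (h : I -> V -> R) : (forall i, test_fun i (h i)) ->
  Ex P (fun w => \prod_i h i (Y i w)) = \prod_i Ex P (fun w => h i (Y i w)).
Proof.
(* Induction on the indices [s] at which [h] is not yet known to be an indicator. *)
move: (enum I) (mem_enum I) => s sI th.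
have {sI} : forall i, i \notin s -> exists2 B : set (borel V), measurable B & h i = \1_B.
  by move=> i; rewrite sI.
elim: s h th => [|i s ih] h th ind.
  have /choice[B B_] : forall i, exists B : set (borel V), measurable B /\ h i = \1_B.
    by move=> i; have [B] := ind i isT; exists B.
  have mB i : measurable (B i) by case: (B_ i).
  have hB i : h i = \1_(B i) by case: (B_ i).
  have mYB i : measurable (Y i @^-1` B i) by rewrite -[X in measurable X]setTI; exact: mY.
  apply: EFin_inj.
  have -> : (fun w => \prod_i h i (Y i w)) =
      \1_(\bigcap_(i in [set` [set: I]%SET]) (Y i @^-1` B i)).
    apply/funext => w; rewrite indicE; have [wB|wB] := boolP (w \in _).
      rewrite big1// => i _; rewrite hB indicE mem_set//.
      by move/set_mem : wB; apply; exact: finset.in_setT.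
    have [i iB] : exists i, ~ B i (Y i w).
      apply: contrapT => nex; move: wB; rewrite notin_setE; apply => i _.
      by apply: contrapT => Bi; apply: nex; exists i.
    by rewrite (bigD1 i)//= hB indicE memNset ?mul0r.
  rewrite Ex_indic; last by apply: fin_bigcap_measurable => // i _; exact: mYB.
  rewrite iY; last by move=> i _; exact: mB.
  rewrite -prodEFin; apply: eq_big => [i|i _]; first by rewrite inE.
  rewrite -Ex_indic//; congr (Ex _ _)%:E; apply/funext => w; rewrite hB !indicE.
  by congr (_%:R); apply/idP/idP; rewrite !inE.
have bh j : bmf (fun w => h j (Y j w)) by exact: test_fun_bmf.
(* [Z] is the product of the other factors minus the product [c] of their means. That [Z] is
   orthogonal to indicators of [Y i] is the induction hypothesis with the factor at [i] replaced by
   an indicator. *)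
set c := \prod_(j | j != i) Ex P (fun w => h j (Y j w)).
pose Z w := \prod_(j | j != i) h j (Y j w) - c.
have bp : bmf (fun w => \prod_(j | j != i) h j (Y j w)) by exact: bmf_prod.
have bZ : bmf Z by apply: bmfB => //; exact: bmf_cst.
have subE g : bmf (fun w => g (Y i w)) -> Ex P (fun w => g (Y i w) * Z w) =
    Ex P (fun w => g (Y i w) * \prod_(j | j != i) h j (Y j w)) -
    Ex P (fun w => g (Y i w)) * c.
  move=> bg; rewrite -ExZr// -ExB; [|exact: bmfM|by apply: bmfM => //; exact: bmf_cst].
  by congr (Ex _ _); apply/funext => w; rewrite /Z mulrBr.
have [mhi [M hM]] := th i.
rewrite [RHS](bigD1 i)//=.
have := @Ex_orthogonal _ _ _ _ _ P (Y i : _ -> borel V) Z (h i) M (mY i) bZ mhi hM.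
rewrite subE// => orth; rewrite -[RHS]add0r -orth ?subrK//.
  by congr (Ex _ _); apply/funext => w; rewrite (bigD1 i).
move=> B mB; rewrite subE; last exact: (test_fun_bmf (test_fun_indic i mB)).
pose h' j := if j == i then \1_B else h j.
have h'i : h' i = \1_B by rewrite /h' eqxx.
have h'j j : j != i -> h' j = h j by rewrite /h' => /negPf ->.
have := ih h'; rewrite (bigD1 i)//= h'i (_ : \prod_(j | j != i) _ = c); last first.
  by apply: eq_bigr => j /h'j ->.
move=> <-.
- apply/eqP; rewrite subr_eq0; apply/eqP; congr (Ex _ _); apply/funext => w.
  by rewrite [RHS](bigD1 i)//= h'i; congr (_ * _); apply: eq_bigr => j /h'j ->.
- by move=> j; rewrite /h'; case: eqP => // _; exact: test_fun_indic.
- move=> j js; rewrite /h'; case: eqP => [_|/eqP ji]; first by exists B.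
  by apply: ind; rewrite inE negb_or ji.
Qed.

End product_formula.

Lemma continuous_borel_measurable {R : realType} (V : ptopologicalType) (f : V -> R) :
  continuous f -> measurable_fun setT (f : borel V -> R).
Proof.
move=> cf; apply: (measurability _ (RGenOInfty.measurableE R)) => _ [_ [x ->] <-].
rewrite setTI; apply: sub_sigma_algebra.
by move/continuousP: cf; apply; exact: interval_open.
Qed.

Section separable.
Context {d : measure_display} {Om : measurableType d} {R : realType}.
Variable P : probability Om R.
Context {m n : nat}.
Variable X : Om -> 'M[R]_(m, n).
Let Y (j : 'I_n) w := col j (X w).
Hypothesis mX : forall j, measurable_fun setT (Y j : Om -> borel 'cV[R]_m).
Hypothesis iX : mutually_independent P Y.
Hypothesis bX : forall i j, exists M, forall w, `|X w i j| <= M.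
Implicit Types F G : 'M[R]_(m, n) -> R.

(** An algebra containing the entries, hence all polynomials in them; Euclidean norms are reached
    through their squares. On it, integrating out some columns is explicit: their factors become
    constants. *)
Definition separable F := exists (K : finType) (c : K -> R) (g : K -> 'I_n -> 'cV[R]_m -> R),
  (forall k j, test_fun Y j (g k j)) /\
  forall M, F M = \sum_k c k * \prod_j g k j (col j M).

Lemma separable_cst (c : R) : separable (fun=> c).
Proof.
exists unit, (fun=> c), (fun _ _ _ => 1); split; first by move=> _ j; exact: test_fun_cst.
by move=> M; rewrite big_const card_unit/= addr0 big1 ?mulr1.
Qed.

Lemma separable_coord i j : separable (fun M => M i j).
Proof.
exists unit, (fun=> 1), (fun _ l v => if l == j then v i 0 else 1); split.
  move=> _ l; have [->|lj] := eqVneq l j; last exact: test_fun_cst.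
  split; first by apply: continuous_borel_measurable; exact: coord_continuous.
  by have [M XM] := bX i j; exists M => w; rewrite /Y mxE.
move=> M; rewrite big_const card_unit/= addr0 mul1r (bigD1 j)//= eqxx mxE big1 ?mulr1//.
by move=> l /negPf ->.
Qed.

Lemma separableD F G : separable F -> separable G -> separable (fun M => F M + G M).
Proof.
move=> [K [c [g [tg FE]]]] [L [e [h [th GE]]]].
exists (K + L)%type, (fun z => match z with inl k => c k | inr l => e l end),
  (fun z => match z with inl k => g k | inr l => h l end); split; first by case.
by move=> M; rewrite big_sumType/= FE GE.
Qed.

Lemma separableM F G : separable F -> separable G -> separable (fun M => F M * G M).
Proof.
move=> [K [c [g [tg FE]]]] [L [e [h [th GE]]]].
exists (K * L)%type, (fun z => c z.1 * e z.2), (fun z j v => g z.1 j v * h z.2 j v).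
split; first by move=> z j; exact: test_funM.
move=> M; rewrite FE GE big_distrlr pair_bigA; apply: eq_bigr => z _ /=.
by rewrite big_split/= mulrACA.
Qed.

Lemma separable_sum (I : Type) (r : seq I) (Q : pred I) (F : I -> 'M[R]_(m, n) -> R) :
  (forall i, Q i -> separable (F i)) -> separable (fun M => \sum_(i <- r | Q i) F i M).
Proof.
move=> sF; elim: r => [|i r ih].
  have -> : (fun M => \sum_(i <- [::] | Q i) F i M) = fun=> 0.
    by apply/funext => M; rewrite big_nil.
  exact: separable_cst.
have -> : (fun M => \sum_(j <- i :: r | Q j) F j M) =
    fun M => (if Q i then F i M else 0) + \sum_(j <- r | Q j) F j M.
  by apply/funext => M; rewrite big_cons; case: ifP => // _; rewrite add0r.
by apply: separableD => //; case: (Q i) (sF i) => [/(_ isT)//|_]; exact: separable_cst.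
Qed.

Lemma separableX F k : separable F -> separable (fun M => F M ^+ k).
Proof.
move=> sF; elim: k => [|k ih]; first exact: separable_cst.
by under eq_fun do rewrite exprS; exact: separableM.
Qed.

(** With [M = X w] and [N = X w'] for two sample points, this is the decoupled matrix; integrating
    in [w] and then in [w'] stands for an independent copy on a product space. *)
Definition mix (I : {set 'I_n}) (M N : 'M[R]_(m, n)) : 'M[R]_(m, n) :=
  \matrix_(i, j) if j \in I then M i j else N i j.

Lemma col_mix I M N j : col j (mix I M N) = if j \in I then col j M else col j N.
Proof. by apply/colP => i; rewrite !mxE; case: ifP; rewrite mxE. Qed.

Lemma separable_bmf F : separable F -> bmf (fun w => F (X w)).
Proof.
move=> [K [c [g [tg FE]]]]; under eq_fun do rewrite FE.
by apply: bmf_sum => k _; apply/bmfZ/bmf_prod => j _; exact: test_fun_bmf (tg k j).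
Qed.

Lemma Ex_separable K (c : K -> R) (g : K -> 'I_n -> 'cV[R]_m -> R) (r : seq K) :
  (forall k j, test_fun Y j (g k j)) ->
  Ex P (fun w => \sum_(k <- r) c k * \prod_j g k j (Y j w)) =
  \sum_(k <- r) c k * \prod_j Ex P (fun w => g k j (Y j w)).
Proof.
move=> tg; have bg k j : bmf (fun w => g k j (Y j w)) by exact: test_fun_bmf (tg k j).
rewrite Ex_sum => [|k _]; last exact/bmfZ/bmf_prod.
by apply: eq_bigr => k _; rewrite ExZ ?Ex_prod//; exact: bmf_prod.
Qed.

(** Integrating in [w] averages the factors with index in [I], integrating in [w'] the others, so
    both sides are the same combination of products of means. This acts as conditioning on the
    columns outside [I]. *)
Lemma Ex_mix F (I : {set 'I_n}) : separable F ->
  bmf (fun w' => Ex P (fun w => F (mix I (X w) (X w')))) /\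
  Ex P (fun w => F (X w)) = Ex P (fun w' => Ex P (fun w => F (mix I (X w) (X w')))).
Proof.
move=> [K [c [g [tg FE]]]].
pose a k j := Ex P (fun w => g k j (Y j w)).
pose G k j (v : 'cV[R]_m) := if j \in I then a k j else g k j v.
have tG k j : test_fun Y j (G k j).
  by rewrite /G; case: (j \in I) => //; exact: test_fun_cst.
have E1 w' : Ex P (fun w => F (mix I (X w) (X w'))) = \sum_k c k * \prod_j G k j (Y j w').
  pose h k j v := if j \in I then g k j v else g k j (Y j w').
  have th k j : test_fun Y j (h k j).
    by rewrite /h; case: (j \in I) => //; exact: test_fun_cst.
  rewrite [X in Ex P X](_ : _ = (fun w => \sum_k c k * \prod_j h k j (Y j w))); last first.
    apply/funext => w; rewrite FE; apply: eq_bigr => k _; congr (_ * _).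
    by apply: eq_bigr => j _; rewrite col_mix /h; case: (j \in I).
  rewrite Ex_separable//; apply: eq_bigr => k _; congr (_ * _).
  apply: eq_bigr => j _; rewrite /h /G; case: (j \in I) => //; exact: Ex_cst.
split.
  under eq_fun do rewrite E1.
  by apply: bmf_sum => k _; apply/bmfZ/bmf_prod => j _; exact: test_fun_bmf (tG k j).
under [X in _ = Ex P X]eq_fun do rewrite E1.
under [X in Ex P X = _]eq_fun do rewrite FE.
rewrite !Ex_separable//; apply: eq_bigr => k _; congr (_ * _); apply: eq_bigr => j _.
by rewrite /G /a; case: (j \in I) => //; rewrite Ex_cst.
Qed.

End separable.

(** * Moments of sums of independent variables *)

Section elementary.
Context {R : realType}.
Implicit Types x h : R.

Lemma exp_partial_sum_le x k : 0 <= x -> \sum_(0 <= i < k) x ^+ i / i`!%:R <= expR x.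
Proof.
move=> x0; apply: (@nondecreasing_cvgn_le _ (series (exp_coeff x))).
  apply/nondecreasing_seqP => j; rewrite /series/= big_nat_recr//= lerDl.
  by rewrite exp_coeff_ge0.
exact: is_cvg_series_exp_coeff.
Qed.

Lemma fact_double_ge i : (i ^ i * i`! <= (i.*2)`!)%N.
Proof.
have -> : (i.*2)`! = (i.*2 ^_ i * i`!)%N.
  by have := @ffact_fact i.*2 i; rewrite -addnn leq_addr addnK => /(_ isT) <-.
rewrite leq_mul2r; apply/orP; right; rewrite ffact_prod.
rewrite -[X in (_ ^ X)%N]card_ord -prod_nat_const; apply: leq_prod => j _.
by have := ltn_ord j; lia.
Qed.

(** Up to the factor [x ^ s / (s + 2)!] the difference of the two sides is a quadratic in [x] with
    discriminant [- s (s + 2)]. *)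
Lemma exp_term_le x s : 0 <= x ->
  x ^+ s.+1 / s.+1`!%:R <= x ^+ s / s`!%:R / 2 + x ^+ s.+2 / s.+2`!%:R.
Proof.
move=> x0; have fs : (s`!)%:R != 0 :> R by rewrite pnatr_eq0 -lt0n fact_gt0.
have s1 : s.+1%:R != 0 :> R by rewrite pnatr_eq0.
have s2 : s.+2%:R != 0 :> R by rewrite pnatr_eq0.
rewrite -subr_ge0 [s.+2`!]factS [s.+1`!]factS !natrM.
have -> : x ^+ s / s`!%:R / 2 + x ^+ s.+2 / (s.+2%:R * (s.+1%:R * s`!%:R))
    - x ^+ s.+1 / (s.+1%:R * s`!%:R) =
  x ^+ s / s`!%:R / s.+2%:R / s.+1%:R * (x ^+ 2 - s.+2%:R * x + s.+2%:R * s.+1%:R / 2).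
  by rewrite [x ^+ s.+2]exprSr [x ^+ s.+1]exprSr; field; rewrite fs /= !gt_eqF//;
    have : 0 <= s%:R :> R by []; lra.
rewrite mulr_ge0 ?divr_ge0 ?exprn_ge0//.
rewrite -[s.+2]addn2 -[s.+1]addn1 !natrD; set t := s%:R : R.
have t0 : 0 <= t by rewrite ler0n.
by have := sqr_ge0 (x - (t + 2) / 2); rewrite expr2; nra.
Qed.

(** Odd terms are absorbed by their even neighbours. The extra half of the last even term
    strengthens the induction: it pays for the next odd term. *)
Lemma exp_even_part x r : (0 < r)%N ->
  \sum_(2 <= j < r.*2.+1) `|x| ^+ j / j`!%:R + x ^+ r.*2 / (r.*2)`!%:R / 2
  <= 3 * \sum_(1 <= i < r.+1) x ^+ i.*2 / (i.*2)`!%:R.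
Proof.
have ev i : `|x| ^+ i.*2 = x ^+ i.*2 by rewrite -normrX ger0_norm// exprn_even_ge0// odd_double.
have ge0 i : 0 <= x ^+ i.*2 / (i.*2)`!%:R by rewrite -ev divr_ge0.
elim: r => // -[_ _|r /(_ isT) ih _].
  by rewrite !big_nat1 -(ev 1%N); have := ge0 1%N; rewrite -(ev 1%N); lra.
rewrite doubleS 2?big_nat_recr//= [in X in _ <= X]big_nat_recr//=.
have key := exp_term_le r.+1.*2 (normr_ge0 x); rewrite !ev in key.
move: key ih; rewrite -doubleS ev; have := ge0 r.+2; lra.
Qed.


(** As [(2 i)! >= i ^ i i!], subgaussian growth of the even moments turns into the series of
    [exp (2 h)]. *)
Lemma even_moment_coeff h i : 0 <= h ->
  (i.*2)%:R ^+ i * h ^+ i / (i.*2)`!%:R <= (2 * h) ^+ i / i`!%:R.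
Proof.
move=> h0; have f1 : 0 < (i`!)%:R :> R by rewrite ltr0n fact_gt0.
have f2 : 0 < ((i.*2)`!)%:R :> R by rewrite ltr0n fact_gt0.
rewrite ler_pdivrMr// mulrAC ler_pdivlMr// exprMn.
rewrite [_ * h ^+ i * _]mulrAC [2 ^+ i * _ * _]mulrAC ler_wpM2r ?exprn_ge0//.
rewrite -mul2n [in X in X <= _]natrM exprMn -mulrA ler_wpM2l ?exprn_ge0//.
by rewrite -natrX -natrM ler_nat mul2n fact_double_ge.
Qed.

End elementary.

Section sum_moments.
Context {d : measure_display} {Om : measurableType d} {R : realType}.
Variable P : probability Om R.
Local Notation E := (Ex P).

(** The series is cut at order [2 q], where control of the moments stops. Centring removes the term
    of order 1, so all other nonconstant terms are bounded through even moments. *)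
Lemma moment_series_le (f : Om -> R) (h : R) q k :
  bmf f -> E f = 0 -> 0 <= h ->
  (forall i, (0 < i <= q)%N -> E (fun w => f w ^+ i.*2) <= i.*2%:R ^+ i * h ^+ i) ->
  (k <= q.*2)%N ->
  \sum_(0 <= j < k.+1) `|E (fun w => f w ^+ j)| / j`!%:R <= expR (6 * h).
Proof.
move=> bf f0 h0 fq kq.
have e0 : `|E (fun w => f w ^+ 0)| / 0`!%:R = 1.
  by rewrite (_ : (fun w => _) = fun=> 1) ?Ex_cst ?normr1 ?divr1//; apply/funext.
have ge0 j : 0 <= `|E (fun w => f w ^+ j)| / j`!%:R by rewrite divr_ge0.
case: q fq kq => [_|q fq kq].
  by rewrite leqn0 => /eqP ->; rewrite big_nat1 e0 -expR0 ler_expR mulr_ge0.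
apply: (@le_trans _ _ (\sum_(0 <= j < q.+1.*2.+1) `|E (fun w => f w ^+ j)| / j`!%:R)).
  by rewrite [in leRHS](big_cat_nat (n := k.+1))//= lerDl sumr_ge0.
rewrite big_ltn// big_ltn// e0 (_ : (fun w => f w ^+ 1) = f); last first.
  by apply/funext => w; rewrite expr1.
rewrite f0 normr0 mul0r add0r.
have bnd : \sum_(2 <= j < q.+1.*2.+1) `|E (fun w => f w ^+ j)| / j`!%:R <=
    3 * \sum_(1 <= i < q.+2) (2 * h) ^+ i / i`!%:R.
  apply: (@le_trans _ _ (E (fun w => \sum_(2 <= j < q.+1.*2.+1) `|f w| ^+ j / j`!%:R))).
    rewrite Ex_sum => [|j _]; last first.
      by apply: bmfM; [exact/bmfX/bmf_norm|exact: bmf_cst].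
    apply: ler_sum => j _; rewrite ExZr; last exact/bmfX/bmf_norm.
    rewrite ler_wpM2r ?invr_ge0//; apply: le_trans (Ex_norm _ _) _; first exact: bmfX.
    by rewrite le_eqVlt; apply/orP; left; apply/eqP; congr (E _); apply/funext => w; rewrite normrX.
  apply: (@le_trans _ _ (E (fun w => 3 * \sum_(1 <= i < q.+2) f w ^+ i.*2 / (i.*2)`!%:R))).
    apply: Ex_le.
    - by apply: bmf_sum => j _; apply: bmfM; [exact/bmfX/bmf_norm|exact: bmf_cst].
    - by apply/bmfZ/bmf_sum => j _; apply: bmfM; [exact/bmfX|exact: bmf_cst].
    - move=> w; apply: le_trans (exp_even_part (f w) (ltn0Sn q)).
      by rewrite lerDl !divr_ge0// exprn_even_ge0// odd_double.
  have bt i : bmf (fun w => f w ^+ i.*2 / (i.*2)`!%:R).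
    by apply: bmfM; [exact: bmfX|exact: bmf_cst].
  rewrite ExZ; last exact: bmf_sum.
  rewrite Ex_sum// ler_wpM2l// big_nat_cond [in leRHS]big_nat_cond.
  apply: ler_sum => i; rewrite andbT => iq; rewrite ExZr; last exact: bmfX.
  apply: le_trans (even_moment_coeff i h0); rewrite ler_wpM2r ?invr_ge0//.
  exact: fq.
have part := exp_partial_sum_le q.+2 (mulr_ge0 (ler0n R 2) h0).
rewrite big_ltn// (_ : (2 * h) ^+ 0 / 0`!%:R = 1) in part; last by rewrite expr0 divr1.
(* For [y = expR (2 * h)], the bound [1 + 3 (y - 1)] is the tangent to [y ^ 3] at 1, hence at most
   [y ^ 3]: this is the origin of the 6. *)
apply: (@le_trans _ _ (1 + 3 * (expR (2 * h) - 1))).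
  by rewrite lerD2l; apply: le_trans bnd _; rewrite ler_wpM2l// lerBrDl.
have -> : expR (6 * h) = expR (2 * h) ^+ 3.
  by rewrite -expRM_natl; congr expR; ring.
have : 1 <= expR (2 * h) by rewrite -expR0 ler_expR mulr_ge0.
move: (expR _) => y y1; rewrite -subr_ge0.
rewrite (_ : _ - _ = (y - 1) ^+ 2 * (y + 2)); last by ring.
by rewrite mulr_ge0 ?sqr_ge0//; lra.
Qed.

(** The numbers [E S ^ k / k!] behave as coefficients of a generating function: by the binomial
    formula and independence, a new summand multiplies the bound by its truncated moment series, at
    most [expR (6 * h i)]. *)
Lemma sum_moment_le (I : eqType) (f : I -> Om -> R) (h : I -> R) q (r : seq I) k :
  (forall i, bmf (f i)) -> (forall i, E (f i) = 0) -> (forall i, 0 <= h i) ->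
  (forall i j, (0 < j <= q)%N -> E (fun w => f i w ^+ j.*2) <= j.*2%:R ^+ j * h i ^+ j) ->
  (forall (s : seq I) i a b, i \notin s ->
    E (fun w => (\sum_(j <- s) f j w) ^+ a * f i w ^+ b) =
    E (fun w => (\sum_(j <- s) f j w) ^+ a) * E (fun w => f i w ^+ b)) ->
  uniq r -> (k <= q.*2)%N ->
  `|E (fun w => (\sum_(j <- r) f j w) ^+ k)| <= k`!%:R * expR (6 * \sum_(j <- r) h j).
Proof.
move=> bf f0 h0 fq ind; elim: r k => [|i r ih] k.
  rewrite big_nil mulr0 expR0 mulr1 => _ _; rewrite (_ : (fun w => _) = fun=> 0 ^+ k).
    by rewrite Ex_cst expr0n; case: k => [|k]; rewrite ?normr1 ?normr0 ?fact_ge1// ler0n.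
  by apply/funext => w; rewrite big_nil.
rewrite /= => /andP[ir ur] kq; set S := fun w => \sum_(j <- r) f j w.
have bS : bmf S by exact: bmf_sum.
have -> : (fun w => (\sum_(j <- i :: r) f j w) ^+ k) =
    (fun w => \sum_(j < k.+1) 'C(k, j)%:R * (S w ^+ (k - j) * f i w ^+ j)).
  apply/funext => w; rewrite big_cons addrC exprDn; apply: eq_bigr => j _.
  by rewrite mulr_natl.
have bSf a b : bmf (fun w => S w ^+ a * f i w ^+ b) by apply: bmfM; exact: bmfX.
rewrite Ex_sum => [|j _]; last exact: bmfZ.
apply: le_trans (ler_norm_sum _ _ _) _.
rewrite big_cons mulrDr expRD.
apply: (@le_trans _ _ (\sum_(j < k.+1) k`!%:R * expR (6 * \sum_(j <- r) h j) *
    (`|E (fun w => f i w ^+ j)| / j`!%:R))).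
  apply: ler_sum => j _; rewrite ExZ// normrM ind// normrM normr_nat.
  have jk : (j <= k)%N by rewrite -ltnS.
  rewrite -(bin_fact jk) !natrM.
  have jf : (j`!)%:R != 0 :> R by rewrite pnatr_eq0 -lt0n fact_gt0.
  set e := expR _; set y := `|E (fun w => f i w ^+ j)|.
  have -> : 'C(k, j)%:R * (j`!%:R * (k - j)`!%:R) * e * (y / j`!%:R) =
    'C(k, j)%:R * ((k - j)`!%:R * e * y) by field.
  apply: ler_wpM2l => //; apply: ler_wpM2r; first exact: normr_ge0.
  by apply: ih => //; rewrite (leq_trans _ kq)// leq_subr.
rewrite -mulr_sumr -mulrA [expR (6 * h i) * _]mulrC ler_wpM2l//.
rewrite ler_wpM2l ?expR_ge0//.
rewrite -(big_mkord xpredT (fun j => `|E (fun w => f i w ^+ j)| / j`!%:R)).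
by apply: (@moment_series_le (f i) (h i) q k) => // j; exact: fq.
Qed.

End sum_moments.

(** * Euclidean geometry and powers *)

Section euclidean_norm.
Context {R : realType} {n : nat}.
Implicit Types (x y z : 'cV[R]_n) (c : R).

Lemma dotvC x y : dotv x y = dotv y x.
Proof. by apply: eq_bigr => i _; rewrite mulrC. Qed.

Lemma dotvDl x y z : dotv (x + y) z = dotv x z + dotv y z.
Proof. by rewrite -big_split; apply: eq_bigr => i _; rewrite mxE mulrDl. Qed.

Lemma dotvDr x y z : dotv x (y + z) = dotv x y + dotv x z.
Proof. by rewrite !(dotvC x) dotvDl. Qed.

Lemma dotvZl c x y : dotv (c *: x) y = c * dotv x y.
Proof. by rewrite mulr_sumr; apply: eq_bigr => i _; rewrite mxE mulrA. Qed.

Lemma dotvZr c x y : dotv x (c *: y) = c * dotv x y.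
Proof. by rewrite !(dotvC x) dotvZl. Qed.

Lemma dotv0l x : dotv 0 x = 0.
Proof. by rewrite -(scale0r x) dotvZl mul0r. Qed.

Lemma dotv_suml (I : Type) (r : seq I) (Q : pred I) (F : I -> 'cV[R]_n) y :
  dotv (\sum_(i <- r | Q i) F i) y = \sum_(i <- r | Q i) dotv (F i) y.
Proof.
by elim/big_rec2 : _ => [|i a b _ <-]; [exact: dotv0l | exact: dotvDl].
Qed.

Lemma dotv_sumr (I : Type) (r : seq I) (Q : pred I) (F : I -> 'cV[R]_n) y :
  dotv y (\sum_(i <- r | Q i) F i) = \sum_(i <- r | Q i) dotv y (F i).
Proof. by rewrite dotvC dotv_suml; apply: eq_bigr => i _; rewrite dotvC. Qed.

Lemma dotv_ge0 x : 0 <= dotv x x.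
Proof. by apply: sumr_ge0 => i _; rewrite -expr2 sqr_ge0. Qed.

Lemma l2norm_ge0 x : 0 <= l2norm x.
Proof. exact: sqrtr_ge0. Qed.

Lemma sqr_l2norm x : l2norm x ^+ 2 = dotv x x.
Proof. by rewrite sqr_sqrtr// dotv_ge0. Qed.

Lemma l2norm_eq0 x : (l2norm x == 0) = (x == 0).
Proof.
apply/eqP/eqP => [x0|->]; last by rewrite /l2norm dotv0l sqrtr0.
have : dotv x x = 0 by rewrite -sqr_l2norm x0 expr0n.
move/psumr_eq0P => xi0; apply/colP => i; rewrite mxE; apply/eqP.
by rewrite -sqrf_eq0 expr2 xi0// => j _; rewrite -expr2 sqr_ge0.
Qed.

Lemma l2norm0 : l2norm (0 : 'cV[R]_n) = 0.
Proof. by apply/eqP; rewrite l2norm_eq0. Qed.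

Lemma l2norm_gt0 x : (0 < l2norm x) = (x != 0).
Proof. by rewrite lt_neqAle l2norm_ge0 andbT eq_sym l2norm_eq0. Qed.

Lemma l2normZ c x : l2norm (c *: x) = `|c| * l2norm x.
Proof. by rewrite /l2norm dotvZl dotvZr mulrA -expr2 sqrtrM ?sqr_ge0// sqrtr_sqr. Qed.

Lemma l2normN x : l2norm (- x) = l2norm x.
Proof. by rewrite -scaleN1r l2normZ normrN1 mul1r. Qed.

Lemma dotv_le x y : dotv x y <= l2norm x * l2norm y.
Proof.
have [->|y0] := eqVneq y 0; first by rewrite dotvC dotv0l l2norm0 mulr0.
have [->|x0] := eqVneq x 0; first by rewrite dotv0l l2norm0 mul0r.
have a0 : 0 < l2norm x by rewrite l2norm_gt0.
have b0 : 0 < l2norm y by rewrite l2norm_gt0.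
have := dotv_ge0 (l2norm y *: x + (- l2norm x) *: y).
rewrite !(dotvDl, dotvDr, dotvZl, dotvZr) -!sqr_l2norm (dotvC y x).
move: (l2norm x) (l2norm y) (dotv x y) a0 b0 => a b c a0 b0.
rewrite (_ : b * _ + _ = (a * b) * (2 * (a * b - c))); last by ring.
by rewrite pmulr_rge0 ?mulr_gt0// pmulr_rge0// subr_ge0.
Qed.

Lemma l2normD x y : l2norm (x + y) <= l2norm x + l2norm y.
Proof.
rewrite -(@ler_pXn2r _ 2) ?nnegrE ?addr_ge0 ?l2norm_ge0//.
rewrite sqr_l2norm !(dotvDl, dotvDr) sqrrD -!sqr_l2norm (dotvC y x).
have := dotv_le x y; lra.
Qed.

Lemma l2norm_dist x y : `|l2norm x - l2norm y| <= l2norm (x - y).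
Proof.
have le (u v : 'cV[R]_n) : l2norm u - l2norm v <= l2norm (u - v).
  by have := l2normD (u - v) v; rewrite subrK lerBlDr.
have := le x y; have := le y x; rewrite -(opprB x y) l2normN ler_norml => h1 h2.
by apply/andP; split; lra.
Qed.

Lemma coord_le_l2norm x i : `|x i 0| <= l2norm x.
Proof.
rewrite -sqrtr_sqr ler_wsqrtr// /dotv (bigD1 i)//= -expr2 lerDl.
by apply: sumr_ge0 => j _; rewrite -expr2 sqr_ge0.
Qed.

Definition restr (v : 'cV[R]_n) (I : {set 'I_n}) : 'cV[R]_n :=
  \col_i if i \in I then v i 0 else 0.

Lemma l2norm_restr v I : l2norm (restr v I) <= l2norm v.
Proof.
apply: ler_wsqrtr; apply: ler_sum => i _; rewrite !mxE; case: ifP => // _.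
by rewrite mul0r -expr2 sqr_ge0.
Qed.

End euclidean_norm.

Lemma mulmx_sum_col {R : realType} {m n : nat} (A : 'M[R]_(m, n)) (x : 'cV[R]_n) :
  A *m x = \sum_j x j 0 *: col j A.
Proof.
apply/colP => i; rewrite mxE summxE; apply: eq_bigr => j _.
by rewrite !mxE mulrC.
Qed.

Section powers.
Context {R : realType}.
Implicit Types a b : R.

Lemma exprD_le a b p : 0 <= a -> 0 <= b -> (a + b) ^+ p <= 2 ^+ p * (a ^+ p + b ^+ p).
Proof.
move=> a0 b0; apply: (@le_trans _ _ ((2 * Num.max a b) ^+ p)).
  have am : a <= Num.max a b by rewrite le_max lexx.
  have bm : b <= Num.max a b by rewrite le_max lexx orbT.
  by apply: lerXn2r; rewrite ?nnegrE; lra.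
rewrite exprMn ler_wpM2l ?exprn_ge0//.
by case: (leP a b) => _; rewrite ?lerDl ?lerDr exprn_ge0.
Qed.

Lemma exprD_ge a b p : (0 < p)%N -> 0 <= a -> 0 <= b -> a ^+ p + b ^+ p <= (a + b) ^+ p.
Proof.
case: p => // p _ a0 b0; elim: p => // p ih.
rewrite !(exprS _ p.+1); apply: (@le_trans _ _ ((a + b) * (a ^+ p.+1 + b ^+ p.+1))).
  by have := mulr_ge0 a0 (exprn_ge0 p.+1 b0); have := mulr_ge0 b0 (exprn_ge0 p.+1 a0); lra.
by rewrite ler_wpM2l// addr_ge0.
Qed.

Lemma even_pow2 l : (0 < l)%N -> ~~ odd (2 ^ l).
Proof. by case: l => // l _; rewrite oddX. Qed.

Lemma expr_pow2S a l : a ^+ (2 ^ l.+1) = (a ^+ 2) ^+ (2 ^ l).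
Proof. by rewrite -exprM expnS. Qed.

(** For dyadic exponents convexity reduces, by repeated squaring, to the nonnegativity of a
    variance. *)
Lemma jensen_pow2 (I : finType) (f : I -> R) l : (0 < #|I|)%N ->
  (#|I|%:R^-1 * \sum_i f i) ^+ (2 ^ l) <= #|I|%:R^-1 * \sum_i f i ^+ (2 ^ l).
Proof.
move=> I0; set N := #|I|%:R^-1; have N0 : 0 < N by rewrite invr_gt0 ltr0n.
have NE : N * #|I|%:R = 1 by rewrite mulVf// pnatr_eq0 -lt0n.
elim: l f => [|l ih] f.
  by rewrite expr1; under [X in _ <= _ * X]eq_bigr do rewrite expr1.
rewrite expr_pow2S; have -> : \sum_i f i ^+ (2 ^ l.+1) = \sum_i (f i ^+ 2) ^+ (2 ^ l).
  by apply: eq_bigr => i _; rewrite expr_pow2S.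
apply: le_trans (ih _).
apply: lerXn2r; rewrite ?nnegrE ?sqr_ge0//.
  by apply: mulr_ge0; [exact: ltW|apply: sumr_ge0 => i _; rewrite sqr_ge0].
set a := N * \sum_i f i.
have : 0 <= N * \sum_i (f i - a) ^+ 2.
  by apply: mulr_ge0; [exact: ltW|apply: sumr_ge0 => i _; rewrite sqr_ge0].
have -> : \sum_i (f i - a) ^+ 2 = \sum_i f i ^+ 2 - (2 * a) * (\sum_i f i) + #|I|%:R * a ^+ 2.
  rewrite (eq_bigr (fun i => f i ^+ 2 - (2 * a) * f i + a ^+ 2)); last by move=> i _; ring.
  by rewrite !big_split/= sumrN -mulr_sumr sumr_const [#|I|%:R * _]mulr_natl.
have aE : N * \sum_i f i = a by [].
rewrite (_ : N * _ = N * (\sum_i f i ^+ 2) - 2 * a * (N * \sum_i f i) + (N * #|I|%:R) * a ^+ 2).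
  by rewrite aE NE expr2; lra.
by ring.
Qed.

End powers.

(** * Decoupling *)

Section decoupling_identity.
Context {R : realType} {m n : nat}.
Implicit Types (M : 'M[R]_(m, n)) (u v : 'cV[R]_n).

(** [<M u, M v>] without its diagonal terms, which are deterministic when the columns have a fixed
    norm. *)
Definition offdiag u v M : R :=
  \sum_i \sum_(j | j != i) u i 0 * v j 0 * dotv (col i M) (col j M).

Lemma dotv_mulmx u v M (lam : R) : (forall j, l2norm (col j M) = lam) ->
  dotv (M *m u) (M *m v) = lam ^+ 2 * dotv u v + offdiag u v M.
Proof.
move=> lamM; rewrite !mulmx_sum_col dotv_suml mulr_sumr -big_split/=.
apply: eq_bigr => i _; rewrite dotvZl dotv_sumr mulr_sumr (bigD1 i)//=; congr (_ + _).
  by rewrite dotvZr -sqr_l2norm lamM; ring.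
by apply: eq_bigr => j _; rewrite dotvZr; ring.
Qed.

Definition halves u v M (f : {ffun 'I_n -> bool}) : R :=
  \sum_(i | f i) \sum_(j | ~~ f j) u i 0 * v j 0 * dotv (col i M) (col j M).

(** A uniformly random [f] selects [i] and rejects [j] with probability 1/4, whence the factor 4 of
    decoupling. The count factors over the coordinates of [f]. *)
Lemma card_separating (i j : 'I_n) : j != i ->
  4 * (\sum_(f : {ffun 'I_n -> bool}) (f i && ~~ f j)%:R) = #|{ffun 'I_n -> bool}|%:R :> R.
Proof.
move=> ji; pose c (k : 'I_n) (b : bool) : R :=
  if k == i then b%:R else if k == j then (~~ b)%:R else 1.
have -> : \sum_(f : {ffun 'I_n -> bool}) (f i && ~~ f j)%:R =
    \sum_(f : {ffun 'I_n -> bool}) \prod_k c k (f k).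
  apply: eq_bigr => f _; rewrite (bigD1 i)//= (bigD1 j)//= big1 ?mulr1; last first.
    by move=> k /andP[/negPf ki /negPf kj]; rewrite /c ki kj.
  by rewrite /c eqxx (negPf ji) eqxx -natrM mulnb.
have -> : #|{ffun 'I_n -> bool}|%:R = \prod_(k < n) (2%:R : R).
  by rewrite card_ffun card_bool card_ord prodr_const card_ord natrX.
rewrite -(bigA_distr_bigA c)/= [in LHS](bigD1 i)//= [in LHS](bigD1 j)//=.
rewrite [in RHS](bigD1 i)//= [in RHS](bigD1 j)//=.
rewrite !big_bool/= /c eqxx (negPf ji) eqxx/=.
have -> : \prod_(k | (k != i) && (k != j)) \sum_(b : bool) (if k == i then b%:R else
    if k == j then (~~ b)%:R else 1 : R) = \prod_(k < n | (k != i) && (k != j)) (2 : R).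
  by apply: eq_bigr => k /andP[/negPf ki /negPf kj]; rewrite big_bool/= ki kj.
ring.
Qed.

Lemma offdiag_avg u v M :
  offdiag u v M = 4 * (#|{ffun 'I_n -> bool}|%:R^-1 * \sum_f halves u v M f).
Proof.
set N := #|{ffun 'I_n -> bool}|%:R; have N0 : N != 0.
  by rewrite /N card_ffun card_bool pnatr_eq0 -lt0n expn_gt0.
apply: (mulfI N0); rewrite [RHS]mulrCA [N * (N^-1 * _)]mulrA divff// mul1r.
pose a i j := u i 0 * v j 0 * dotv (col i M) (col j M).
have hE f : halves u v M f = \sum_i \sum_(j | j != i) (f i && ~~ f j)%:R * a i j.
  rewrite /halves big_mkcond; apply: eq_bigr => i _; case: ifP => fi; last first.
    by rewrite big1// => j _; rewrite mul0r.
  rewrite big_mkcond [RHS]big_mkcond; apply: eq_bigr => j _.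
  have [->|ji] := eqVneq j i; first by rewrite fi.
  by case: (f j); rewrite ?mul0r ?mul1r.
under [in RHS]eq_bigr do rewrite hE.
rewrite exchange_big mulr_sumr [in RHS]mulr_sumr; apply: eq_bigr => i _ /=.
rewrite exchange_big mulr_sumr [in RHS]mulr_sumr; apply: eq_bigr => j ji /=.
by rewrite -mulr_suml [RHS]mulrA card_separating.
Qed.

(** A linear form in the columns selected by [f], tested against a vector built from the other
    columns only; the latter can then be frozen. *)
Lemma halvesE u v M f : halves u v M f =
  \sum_(i | f i) u i 0 * dotv (col i M) (M *m restr v [set j | ~~ f j]%SET).
Proof.
apply: eq_bigr => i _; rewrite mulmx_sum_col dotv_sumr mulr_sumr [LHS]big_mkcond.
apply: eq_bigr => j _; rewrite dotvZr mxE inE; case: ifP => _; ring.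
Qed.

End decoupling_identity.

Lemma fact_le_exp k : (k`! <= k ^ k)%N.
Proof.
elim: k => // k ih; rewrite factS expnS leq_mul2l /= (leq_trans ih)//.
by case: k {ih} => // k; rewrite leq_exp2r.
Qed.

(** * Moment inequalities written without roots *)

Section moment_calculus.
Context {d : measure_display} {Om : measurableType d} {R : realType}.
Variable P : probability Om R.
Local Notation E := (Ex P).
Implicit Types (f g : Om -> R) (a b : R).

(** Minkowski's inequality up to a factor 2. *)
Lemma momentD f g a b p : (0 < p)%N -> bmf f -> bmf g ->
  (forall w, 0 <= f w) -> (forall w, 0 <= g w) -> 0 <= a -> 0 <= b ->
  E (fun w => f w ^+ p) <= a ^+ p -> E (fun w => g w ^+ p) <= b ^+ p ->
  E (fun w => (f w + g w) ^+ p) <= (2 * (a + b)) ^+ p.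
Proof.
move=> p0 bf bg f0 g0 a0 b0 fa gb.
apply: (@le_trans _ _ (E (fun w => 2 ^+ p * (f w ^+ p + g w ^+ p)))).
  apply: Ex_le; [exact/bmfX/bmfD|by apply/bmfZ/bmfD; exact: bmfX|].
  by move=> w; exact: exprD_le.
rewrite ExZ; last by apply: bmfD; exact: bmfX.
rewrite ExD; [|exact: bmfX|exact: bmfX].
rewrite exprMn ler_wpM2l ?exprn_ge0//; apply: le_trans (exprD_ge p0 a0 b0).
exact: lerD.
Qed.

Lemma momentM f g a b p : bmf f -> bmf g ->
  (forall w, 0 <= f w) -> (forall w, 0 <= g w) -> 0 < a -> 0 < b ->
  E (fun w => f w ^+ p.*2) <= a ^+ p.*2 -> E (fun w => g w ^+ p.*2) <= b ^+ p.*2 ->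
  E (fun w => (f w * g w) ^+ p) <= (a * b) ^+ p.
Proof.
move=> bf bg f0 g0 a0 b0 fa gb.
have ap : 0 < a ^+ p by exact: exprn_gt0.
have bp : 0 < b ^+ p by exact: exprn_gt0.
(* Cauchy-Schwarz through [x y <= t x ^ 2 / 2 + y ^ 2 / (2 t)], with the [t] that balances the two
   moment bounds. *)
pose t := b ^+ p / a ^+ p; have t0 : 0 < t by rewrite divr_gt0.
apply: (@le_trans _ _ (E (fun w => t / 2 * f w ^+ p.*2 + t^-1 / 2 * g w ^+ p.*2))).
  apply: Ex_le; [exact/bmfX/bmfM|by apply: bmfD; apply/bmfZ/bmfX|].
  move=> w; rewrite exprMn -!addnn !exprD.
  move: (f w ^+ p) (g w ^+ p) => x y; rewrite -subr_ge0.
  have -> : t / 2 * (x * x) + t^-1 / 2 * (y * y) - x * y = (t * x - y) ^+ 2 / t / 2.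
    by field; rewrite gt_eqF.
  by rewrite !divr_ge0 ?sqr_ge0// ltW.
rewrite ExD ?ExZ; [|exact: bmfX|exact: bmfX|exact/bmfZ/bmfX|exact/bmfZ/bmfX].
apply: (@le_trans _ _ (t / 2 * a ^+ p.*2 + t^-1 / 2 * b ^+ p.*2)).
  by apply: lerD; apply: ler_wpM2l; rewrite // divr_ge0// ?invr_ge0 ltW.
rewrite exprMn -!addnn !exprD /t le_eqVlt; apply/orP; left; apply/eqP.
by field; rewrite !gt_eqF.
Qed.

Lemma moment_le f g a p : bmf f -> bmf g -> (forall w, 0 <= f w <= g w) ->
  E (fun w => g w ^+ p) <= a ^+ p -> E (fun w => f w ^+ p) <= a ^+ p.
Proof.
move=> bf bg fg; apply: le_trans; apply: Ex_le; [exact: bmfX|exact: bmfX|].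
by move=> w; have /andP[f0 fg'] := fg w; rewrite lerXn2r// nnegrE (le_trans f0).
Qed.

Lemma momentZ c f a p : bmf f -> E (fun w => f w ^+ p) <= a ^+ p -> 0 <= c ->
  E (fun w => (c * f w) ^+ p) <= (c * a) ^+ p.
Proof.
move=> bf fa c0; under [X in E X]eq_fun do rewrite exprMn.
by rewrite ExZ ?exprMn ?ler_wpM2l ?exprn_ge0//; exact: bmfX.
Qed.

Lemma moment_weaken f a b p : E (fun w => f w ^+ p) <= a ^+ p -> 0 <= a <= b ->
  E (fun w => f w ^+ p) <= b ^+ p.
Proof.
by move=> fa /andP[a0 ab]; apply: le_trans fa _; rewrite lerXn2r// nnegrE (le_trans a0).
Qed.

End moment_calculus.

(** * Moments of the off-diagonal form, of the norms and of the increments *)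

Definition devp {R : realType} {m n : nat} (lam : R) (x : 'cV[R]_n) (M : 'M[R]_(m, n)) : R :=
  l2norm (M *m x) - lam * l2norm x.

Section chaos_moments.
Context {d : measure_display} {Om : measurableType d} {R : realType}.
Variable P : probability Om R.
Local Notation E := (Ex P).
Context {m n : nat}.
Variables (X : Om -> 'M[R]_(m, n)) (lam : R) (La : nat -> R).
Hypothesis mX : forall j, measurable_fun setT ((fun w => col j (X w)) : Om -> borel 'cV[R]_m).
Hypothesis iX : mutually_independent P (fun (j : 'I_n) w => col j (X w)).
Hypothesis lamX : forall j w, l2norm (col j (X w)) = lam.
Hypothesis meanX : forall i j, E (fun w => X w i j) = 0.
Hypothesis La_gt0 : forall l, 0 < La l.
(* [La l] plays the role of [K (2 ^ l) ^ (1 / alpha)]: up to order [2 ^ l] the columns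
   have the moments of a subgaussian vector of variance [La l ^ 2 / 2 ^ l]. *)
Hypothesis momX : forall l j v i, (0 < i)%N -> (i.*2 <= 2 ^ l)%N ->
  E (fun w => dotv (col j (X w)) v ^+ i.*2) <=
  i.*2%:R ^+ i * (La l ^+ 2 / (2 ^ l)%:R * dotv v v) ^+ i.

Lemma entry_bounded i j : exists M, forall w, `|X w i j| <= M.
Proof.
exists lam => w; rewrite -(lamX j w).
by have := coord_le_l2norm (col j (X w)) i; rewrite mxE.
Qed.

Local Notation sep := (separable X).

Lemma separable_dotv_col j v : sep (fun M => dotv (col j M) v).
Proof.
apply: separable_sum => i _; apply: separableM; last exact: separable_cst.
have -> : (fun M : 'M[R]_(m, n) => col j M i 0) = (fun M => M i j).
  by apply/funext => M; rewrite mxE.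
exact: separable_coord entry_bounded _ _.
Qed.

Lemma separable_mulmx (u : 'cV[R]_n) i : sep (fun M => (M *m u) i 0).
Proof.
have -> : (fun M : 'M[R]_(m, n) => (M *m u) i 0) = (fun M => \sum_j M i j * u j 0).
  by apply/funext => M; rewrite mxE.
apply: separable_sum => j _; apply: separableM; last exact: separable_cst.
exact: separable_coord entry_bounded _ _.
Qed.

Lemma separable_dotv (F G : 'M[R]_(m, n) -> 'cV[R]_m) :
  (forall i, sep (fun M => F M i 0)) -> (forall i, sep (fun M => G M i 0)) ->
  sep (fun M => dotv (F M) (G M)).
Proof. by move=> sF sG; apply: separable_sum => i _; apply: separableM. Qed.

Lemma separable_dotv_cols i j : sep (fun M => dotv (col i M) (col j M)).
Proof.
apply: separable_dotv => k; under eq_fun do rewrite mxE;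
  exact: separable_coord entry_bounded _ _.
Qed.

Lemma separable_offdiag u v : sep (offdiag u v).
Proof.
apply: separable_sum => i _; apply: separable_sum => j _; apply: separableM.
  exact: separable_cst.
exact: separable_dotv_cols.
Qed.

Lemma bmf_offdiag u v : bmf (fun w => offdiag u v (X w)).
Proof. exact: (separable_bmf mX (separable_offdiag u v)). Qed.

Lemma bmf_dotv u v : bmf (fun w => dotv (X w *m u) (X w *m v)).
Proof.
apply: (@separable_bmf _ _ _ _ _ X mX (fun M => dotv (M *m u) (M *m v))).
by apply: separable_dotv => i; exact: separable_mulmx.
Qed.

Lemma bmf_l2norm u : bmf (fun w => l2norm (X w *m u)).
Proof. exact: bmf_sqrt (bmf_dotv u u). Qed.

(** Integrating out column [i] alone leaves a linear form in a centred vector. *)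
Lemma Ex_offdiag u v : E (fun w => offdiag u v (X w)) = 0.
Proof.
have bij i j : bmf (fun w => dotv (col i (X w)) (col j (X w))).
  exact: (separable_bmf mX (separable_dotv_cols i j)).
rewrite /offdiag Ex_sum => [|i _]; last by apply: bmf_sum => j _; exact: bmfZ.
rewrite big1// => i _; rewrite Ex_sum => [|j _]; last exact: bmfZ.
rewrite big1// => j ji; rewrite ExZ//.
rewrite (Ex_mix mX iX [set i]%SET (separable_dotv_cols i j)).2.
rewrite [X in E X](_ : _ = fun=> 0) ?Ex_cst ?mulr0//; apply/funext => w'.
rewrite [X in E X](_ : _ = fun w => dotv (col i (X w)) (col j (X w'))); last first.
  by apply/funext => w; rewrite !col_mix !inE eqxx (negPf ji).
rewrite /dotv Ex_sum => [|k _]; last first.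
  apply: bmfM; last exact: bmf_cst.
  under eq_fun do rewrite mxE.
  exact: (separable_bmf mX (separable_coord entry_bounded k i)).
rewrite big1// => k _; rewrite ExZr; last first.
  under eq_fun do rewrite mxE.
  exact: (separable_bmf mX (separable_coord entry_bounded k i)).
by under [X in E X]eq_fun do rewrite mxE; rewrite meanX mul0r.
Qed.

Lemma linear_form_moment l (A : pred 'I_n) (u : 'cV[R]_n) (v : 'cV[R]_m) : (0 < l)%N ->
  E (fun w => (\sum_(i | A i) u i 0 * dotv (col i (X w)) v) ^+ (2 ^ l)) <=
  (expR 6 * La l * l2norm u * l2norm v) ^+ (2 ^ l).
Proof.
move=> l0; have p0 : (0 < 2 ^ l)%N by rewrite expn_gt0.
have bcol i : bmf (fun w => dotv (col i (X w)) v).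
  exact: (separable_bmf mX (separable_dotv_col i v)).
have zero : (forall w, \sum_(i | A i) u i 0 * dotv (col i (X w)) v = 0) ->
    E (fun w => (\sum_(i | A i) u i 0 * dotv (col i (X w)) v) ^+ (2 ^ l)) <=
    (expR 6 * La l * l2norm u * l2norm v) ^+ (2 ^ l).
  move=> S0; under [X in E X]eq_fun do rewrite S0.
  rewrite Ex_cst expr0n (gtn_eqF p0) exprn_ge0// !mulr_ge0 ?l2norm_ge0 ?expR_ge0//.
  exact: ltW.
have [u0|u0] := eqVneq u 0.
  by apply: zero => w; rewrite big1// => i _; rewrite u0 mxE mul0r.
have [v0|v0] := eqVneq v 0.
  by apply: zero => w; rewrite big1// => i _; rewrite v0 dotvC dotv0l mulr0.
have {}u0 : 0 < l2norm u by rewrite l2norm_gt0.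
have {}v0 : 0 < l2norm v by rewrite l2norm_gt0.
have L0 := La_gt0 l.
set p := (2 ^ l)%N in p0 *; have pR : 0 < p%:R :> R by rewrite ltr0n.
(* At this scale the variance proxies [h i] are [p u_i ^ 2 / |u| ^ 2] and sum to at most [p];
   [sum_moment_le] then yields [p! exp (6 p) <= (p exp 6) ^ p]. *)
pose z := p%:R / (La l * l2norm u * l2norm v).
have D0 : 0 < La l * l2norm u * l2norm v by rewrite !mulr_gt0.
have z0 : 0 < z by rewrite divr_gt0.
pose f i w := z * (u i 0 * dotv (col i (X w)) v).
pose h i := p%:R * u i 0 ^+ 2 / l2norm u ^+ 2.
have pE : p = ((2 ^ l.-1).*2)%N by rewrite /p -[in LHS](prednK l0) expnS mul2n.
have sf i : sep (fun M => z * (u i 0 * dotv (col i M) v)).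
  by do 2 (apply: separableM; first exact: separable_cst); exact: separable_dotv_col.
have bf i : bmf (f i) by apply: bmfZ; exact: bmfZ.
have := @sum_moment_le _ _ _ P 'I_n f h (2 ^ l.-1)%N (enum A) p bf.
have f0 i : E (f i) = 0.
  rewrite !ExZ//; last exact: bmfZ.
  rewrite /dotv Ex_sum => [|k _]; last first.
    apply: bmfM; last exact: bmf_cst.
    under eq_fun do rewrite mxE.
    exact: (separable_bmf mX (separable_coord entry_bounded k i)).
  rewrite big1 ?mulr0// => k _; rewrite ExZr; last first.
    under eq_fun do rewrite mxE.
    exact: (separable_bmf mX (separable_coord entry_bounded k i)).
  by under [X in E X]eq_fun do rewrite mxE; rewrite meanX mul0r.
have h0 i : 0 <= h i by rewrite /h divr_ge0 ?sqr_ge0// mulr_ge0 ?sqr_ge0// ler0n.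
have fq i j : (0 < j <= 2 ^ l.-1)%N ->
    E (fun w => f i w ^+ j.*2) <= j.*2%:R ^+ j * h i ^+ j.
  move=> /andP[j0 jq]; under [X in E X]eq_fun do rewrite /f mulrA exprMn.
  rewrite ExZ; last exact: bmfX.
  apply: (@le_trans _ _ ((z * u i 0) ^+ j.*2 *
      (j.*2%:R ^+ j * (La l ^+ 2 / p%:R * dotv v v) ^+ j))).
    by rewrite ler_wpM2l ?exprn_even_ge0 ?odd_double// momX// -/p pE leq_double.
  rewrite mulrCA ler_wpM2l ?exprn_ge0// -mul2n exprM -exprMn.
  rewrite le_eqVlt; apply/orP; left; apply/eqP; congr (_ ^+ j).
  rewrite -sqr_l2norm /h /z; field.
  by rewrite !gt_eqF.
have ind (s : seq 'I_n) i a b : i \notin s ->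
    E (fun w => (\sum_(j <- s) f j w) ^+ a * f i w ^+ b) =
    E (fun w => (\sum_(j <- s) f j w) ^+ a) * E (fun w => f i w ^+ b).
  move=> si.
  pose F (M : 'M[R]_(m, n)) := (\sum_(j <- s) z * (u j 0 * dotv (col j M) v)) ^+ a *
    (z * (u i 0 * dotv (col i M) v)) ^+ b.
  have sF : sep F.
    by apply: separableM; apply: separableX; [apply: separable_sum => j _|]; exact: sf.
  rewrite [LHS](Ex_mix mX iX [set i]%SET sF).2.
  have bS : bmf (fun w => (\sum_(j <- s) f j w) ^+ a) by apply/bmfX/bmf_sum => j _; exact: bf.
  rewrite -ExZr//; congr (E _); apply/funext => w'.
  rewrite -ExZ; last exact: bmfX.
  congr (E _); apply/funext => w; rewrite /F col_mix inE eqxx; congr (_ ^+ _ * _).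
  rewrite !big_seq; apply: eq_bigr => j js; rewrite col_mix inE.
  by case: eqP js si => [->->|].
move=> /(_ f0 h0 fq ind (enum_uniq _)); rewrite -pE => /(_ (leqnn _)) main.
set S := fun w => \sum_(i | A i) u i 0 * dotv (col i (X w)) v.
have bS : bmf S by apply: bmf_sum => i _; exact: bmfZ.
have {}main : z ^+ p * E (fun w => S w ^+ p) <= p%:R ^+ p * expR 6 ^+ p.
  rewrite -ExZ; last exact: bmfX.
  have -> : (fun w => z ^+ p * S w ^+ p) = (fun w => (\sum_(j <- enum A) f j w) ^+ p).
    by apply/funext => w; rewrite -exprMn /S mulr_sumr big_enum.
  apply: le_trans (ler_norm _) _; apply: le_trans main _; rewrite -expRM_natl.
  apply: ler_pM; rewrite ?expR_ge0//.
    by rewrite -natrX ler_nat fact_le_exp.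
  rewrite ler_expR mulrC ler_wpM2r// /h -mulr_suml -mulr_sumr ler_pdivrMr ?exprn_gt0//.
  rewrite ler_wpM2l ?ler0n// sqr_l2norm big_enum/= big_mkcond.
  by apply: ler_sum => i _; rewrite -expr2; case: ifP; rewrite ?sqr_ge0.
rewrite -(ler_pM2l (exprn_gt0 p z0)); apply: le_trans main _; rewrite -!exprMn.
rewrite le_eqVlt; apply/orP; left; apply/eqP; congr (_ ^+ _).
rewrite /z; field; by rewrite !gt_eqF.
Qed.

Lemma mulmx_mix (M N : 'M[R]_(m, n)) (f : {ffun 'I_n -> bool}) v :
  mix [set j | f j]%SET M N *m restr v [set j | ~~ f j]%SET =
  N *m restr v [set j | ~~ f j]%SET.
Proof.
rewrite !mulmx_sum_col; apply: eq_bigr => j _; rewrite col_mix !mxE !inE.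
by case: (f j); rewrite ?scale0r.
Qed.

Let bl2 u : bmf (fun w => l2norm (X w *m u)) := bmf_l2norm u.

(** With the columns outside [f] frozen, the bound on linear forms applies for each frozen value; a
    moment of the norm of [X] applied to a restriction of [v] remains. *)
Lemma halves_moment l u v (f : {ffun 'I_n -> bool}) (c : R) : (0 < l)%N ->
  (forall I, E (fun w => l2norm (X w *m restr v I) ^+ (2 ^ l)) <= c ^+ (2 ^ l)) ->
  E (fun w => halves u v (X w) f ^+ (2 ^ l)) <= (expR 6 * La l * l2norm u * c) ^+ (2 ^ l).
Proof.
move=> l0 hc.
have sF : separable X (fun M => halves u v M f ^+ (2 ^ l)).
  apply: separableX; apply: separable_sum => i _; apply: separable_sum => j _.
  by apply: separableM; [exact: separable_cst|exact: separable_dotv_cols].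
have [bF ->] := Ex_mix mX iX [set j | f j]%SET sF.
have e0 : 0 <= expR 6 * La l * l2norm u.
  by rewrite !mulr_ge0 ?expR_ge0 ?l2norm_ge0// ltW.
set W := fun w => l2norm (X w *m restr v [set j | ~~ f j]%SET).
have bW : bmf W by exact: bl2.
apply: (@le_trans _ _ (E (fun w => (expR 6 * La l * l2norm u * W w) ^+ (2 ^ l)))).
  apply: Ex_le => //; first by apply/bmfX/bmfZ.
  move=> w'; rewrite /W.
  rewrite [X in E X](_ : _ = fun w => (\sum_(i | f i) u i 0 * dotv (col i (X w))
      (X w' *m restr v [set j | ~~ f j]%SET)) ^+ (2 ^ l)).
    by have := linear_form_moment f u _ l0; exact.
  apply/funext => w; rewrite halvesE mulmx_mix; congr (_ ^+ _).
  by apply: eq_bigr => i fi; rewrite col_mix inE fi.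
by apply: momentZ => //; exact: hc.
Qed.

(** Jensen's inequality over the splittings. The hypothesis ranges over all [I] because each
    splitting restricts [v] to its own set. *)
Lemma offdiag_moment l u v (c : R) : (0 < l)%N ->
  (forall I, E (fun w => l2norm (X w *m restr v I) ^+ (2 ^ l)) <= c ^+ (2 ^ l)) ->
  E (fun w => offdiag u v (X w) ^+ (2 ^ l)) <=
  (4 * expR 6 * La l * l2norm u * c) ^+ (2 ^ l).
Proof.
move=> l0 hc; set N := #|{ffun 'I_n -> bool}|.
have N0 : (0 < N)%N by rewrite /N card_ffun card_bool expn_gt0.
have bh f : bmf (fun w => halves u v (X w) f).
  apply: (@separable_bmf _ _ _ _ _ X mX (fun M => halves u v M f)).
  apply: separable_sum => i _; apply: separable_sum => j _.
  by apply: separableM; [exact: separable_cst|exact: separable_dotv_cols].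
apply: (@le_trans _ _ (E (fun w => 4 ^+ (2 ^ l) *
    (N%:R^-1 * \sum_f halves u v (X w) f ^+ (2 ^ l))))).
  apply: Ex_le.
  - exact/bmfX/bmf_offdiag.
  - by apply/bmfZ/bmfZ/bmf_sum => f _; exact: bmfX.
  - by move=> w; rewrite offdiag_avg exprMn ler_wpM2l ?exprn_ge0// jensen_pow2.
rewrite ExZ; last by apply/bmfZ/bmf_sum => f _; exact: bmfX.
rewrite ExZ; last by apply/bmf_sum => f _; exact: bmfX.
rewrite Ex_sum => [|f _]; last exact: bmfX.
rewrite -!(mulrA 4) (exprMn _ 4) ler_wpM2l ?exprn_ge0// ler_pdivrMl ?ltr0n//.
rewrite mulr_natl -sumr_const.
by apply: ler_sum => f _; exact: halves_moment.
Qed.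

Let c0 : R := 4 * expR 6.
Let c0_ge1 : 1 <= c0.
Proof. by have := expR_ge1Dx (6 : R); rewrite /c0; lra. Qed.

(** The positive solution of [B ^ 2 = 2 B + 2 c0 B], the relation that closes the induction in
    [norm_moment] with a constant free of [l]. In [c0], the 4 is due to decoupling and [expR 6] to
    linear forms. *)
Definition normC : R := 2 + 2 * c0.
Local Notation B := normC.

Hypothesis lam_gt0 : 0 < lam.
Hypothesis La_nd : forall l, La l <= La l.+1.

Lemma norm_moment l v : (0 < l)%N ->
  E (fun w => l2norm (X w *m v) ^+ (2 ^ l)) <= (B * (lam + La l) * l2norm v) ^+ (2 ^ l).
Proof.
have B1 : 1 <= B by rewrite /normC; move: c0_ge1; lra.
elim: l v => // -[_ v _|l /(_ _ isT) ih v _].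
  (* At order 2 the off-diagonal part has mean zero, so the moment is computed exactly. *)
  rewrite (_ : (2 ^ 1)%N = 2%N)// [X in E X](_ : _ = fun w =>
    lam ^+ 2 * dotv v v + offdiag v v (X w)); last first.
    by apply/funext => w; rewrite sqr_l2norm (dotv_mulmx _ _ (fun j => lamX j w)).
  rewrite ExD; [|exact: bmf_cst|exact: bmf_offdiag].
  rewrite Ex_cst Ex_offdiag addr0 exprMn sqr_l2norm.
  rewrite ler_wpM2r ?dotv_ge0// lerXn2r ?nnegrE ?(ltW lam_gt0)//.
    by rewrite mulr_ge0//; have := La_gt0 1%N; move: B1 lam_gt0; lra.
  by have := La_gt0 1%N; move: B1 lam_gt0; nra.
(* The moment of order [2 ^ l.+2] of the norm is that of order [2 ^ l.+1] of its square, and the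
   off-diagonal bound at that order requires the norm at the same order only, for the restrictions
   of [v]. *)
set L := La l.+1; set L' := La l.+2; have L0 : 0 < L by exact: La_gt0.
have LL' : L <= L' by exact: La_nd.
have B0 : 0 <= B by move: B1; lra.
have s0 : 0 <= lam + L by move: lam_gt0; lra.
have cp : 0 <= c0 by move: c0_ge1; lra.
have L0' := ltW L0.
set a := l2norm v; have a0 : 0 <= a by exact: l2norm_ge0.
have off : E (fun w => offdiag v v (X w) ^+ (2 ^ l.+1)) <=
    (c0 * L * a * (B * (lam + L) * a)) ^+ (2 ^ l.+1).
  apply: offdiag_moment => // I; apply: moment_weaken (ih _) _.
  by rewrite !mulr_ge0 ?l2norm_ge0//= ler_wpM2l ?l2norm_restr// mulr_ge0.
have -> : (fun w => l2norm (X w *m v) ^+ (2 ^ l.+2)) =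
    (fun w => (lam ^+ 2 * a ^+ 2 + offdiag v v (X w)) ^+ (2 ^ l.+1)).
  apply/funext => w; rewrite expr_pow2S sqr_l2norm (dotv_mulmx _ _ (fun j => lamX j w)).
  by rewrite sqr_l2norm.
rewrite expr_pow2S.
have bo := bmf_offdiag v v.
have ev (x : R) : `|x| ^+ (2 ^ l.+1) = x ^+ (2 ^ l.+1).
  by rewrite -normrX ger0_norm// exprn_even_ge0// even_pow2.
apply: (@le_trans _ _ (E (fun w => (lam ^+ 2 * a ^+ 2 + `|offdiag v v (X w)|) ^+ (2 ^ l.+1)))).
  apply: Ex_le.
  - by apply: bmfX; apply: bmfD => //; exact: bmf_cst.
  - by apply: bmfX; apply: bmfD; [exact: bmf_cst|exact: bmf_norm].
  - move=> w; rewrite -ev; have la0 : 0 <= lam ^+ 2 * a ^+ 2 by rewrite mulr_ge0 ?sqr_ge0.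
    apply: lerXn2r; rewrite ?nnegrE//; first exact: addr_ge0.
    by rewrite -[X in _ <= X + _](ger0_norm la0) ler_normD.
apply: (moment_weaken (a := 2 * (lam ^+ 2 * a ^+ 2 + c0 * L * a * (B * (lam + L) * a)))).
  apply: momentD => //.
  - by rewrite expn_gt0.
  - exact: bmf_cst.
  - exact: bmf_norm.
  - by move=> _; rewrite mulr_ge0 ?sqr_ge0.
  - by rewrite mulr_ge0 ?sqr_ge0.
  - by rewrite !mulr_ge0.
  - by rewrite Ex_cst.
  - by under [X in E X]eq_fun do rewrite ev.
have l0 := lam_gt0; have c1 := c0_ge1.
apply/andP; split.
  apply: mulr_ge0 => //; apply: addr_ge0; first by rewrite mulr_ge0 ?sqr_ge0.
  by rewrite !mulr_ge0.
have -> : 2 * (lam ^+ 2 * a ^+ 2 + c0 * L * a * (B * (lam + L) * a)) =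
  (2 * lam ^+ 2 + 2 * c0 * B * (L * (lam + L))) * a ^+ 2 by ring.
rewrite exprMn ler_wpM2r ?sqr_ge0// exprMn.
set s := lam + L'; apply: (@le_trans _ _ (2 * s ^+ 2 + 2 * c0 * B * s ^+ 2)).
  apply: lerD.
    by rewrite ler_wpM2l// lerXn2r ?nnegrE /s; lra.
  rewrite ler_wpM2l//; first by rewrite !mulr_ge0//; lra.
  by rewrite expr2 ler_pM// /s; lra.
rewrite -mulrDl ler_wpM2r ?sqr_ge0// expr2.
have -> : B * B = 2 * B + 2 * c0 * B by rewrite {1}/normC; ring.
by move: B1; lra.
Qed.

Variable theta : R.
Hypothesis La_doubling : forall l, La l.+1 <= theta * La l.

Let c0_ge0 : 0 <= c0 := le_trans ler01 c0_ge1.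
Let B_ge1 : 1 <= B.
Proof. by rewrite /normC -/c0; move: c0_ge0; lra. Qed.

Let nm l v (l0 : (0 < l)%N) := norm_moment v l0.

Lemma abs_offdiag_moment l u v : (0 < l)%N ->
  E (fun w => `|offdiag u v (X w)| ^+ (2 ^ l)) <=
  (c0 * La l * l2norm u * (B * (lam + La l) * l2norm v)) ^+ (2 ^ l).
Proof.
move=> l0; have L0 := La_gt0 l; have b1 := B_ge1.
under [X in E X]eq_fun do rewrite -normrX ger0_norm ?exprn_even_ge0 ?even_pow2//.
apply: offdiag_moment => // I.
apply: moment_weaken (nm _ l0) _.
have s0 : 0 <= B * (lam + La l) by rewrite mulr_ge0//; move: lam_gt0; lra.
by rewrite mulr_ge0 ?l2norm_ge0//= ler_wpM2l ?l2norm_restr.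
Qed.

Lemma bmf_dev x : bmf (fun w => `|devp lam x (X w)|).
Proof. by apply: bmf_norm; apply: bmfB => //; exact: bmf_cst. Qed.

Lemma bmf_abs_offdiag u v : bmf (fun w => `|offdiag u v (X w)|).
Proof. exact/bmf_norm/(bmf_offdiag). Qed.

(** [2 c0 B] serves the case [La l <= lam], and [4 B + 2] the case [lam < La l]. *)
Definition pointC : R := 2 * c0 * B + 4 * B + 2.

Lemma dev_moment l x : (0 < l)%N ->
  E (fun w => `|devp lam x (X w)| ^+ (2 ^ l)) <= (pointC * La l * l2norm x) ^+ (2 ^ l).
Proof.
move=> l0; set L := La l; have L0 : 0 < L by exact: La_gt0.
have b1 := B_ge1; have cp := c0_ge0; have lp := lam_gt0.
have C0 : 0 <= pointC by rewrite /pointC; have := mulr_ge0 cp (le_trans ler01 b1); lra.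
have p0 : (0 < 2 ^ l)%N by rewrite expn_gt0.
have [->|x0] := eqVneq x 0.
  under [X in E X]eq_fun do rewrite /devp mulmx0 !l2norm0 mulr0 subr0 normr0.
  by rewrite l2norm0 mulr0 Ex_cst.
set a := l2norm x; have a0 : 0 < a by rewrite l2norm_gt0.
have cB : 0 <= c0 * B by rewrite mulr_ge0//; lra.
(* For [lam < L] the triangle inequality is enough. Otherwise [lam |x| |Z x| <= (|A x| + lam |x|) |Z
   x| = |offdiag x x|], and [lam + L <= 2 lam] makes division by [lam |x|] harmless. *)
have [Ll|lL] := leP L lam; last first.
  apply: (@moment_le _ _ _ P _ (fun w => l2norm (X w *m x) + lam * a)).
  - exact: bmf_dev.
  - by apply: bmfD => //; exact: bmf_cst.
  - move=> w; rewrite normr_ge0/= (le_trans (ler_normB _ _))//.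
    by rewrite !ger0_norm ?l2norm_ge0// mulr_ge0// ltW.
  apply: (moment_weaken (a := 2 * (B * (lam + L) * a + lam * a))).
    apply: momentD => //; last by rewrite Ex_cst.
    - exact: bmf_cst.
    - by move=> w; exact: l2norm_ge0.
    - by move=> _; rewrite mulr_ge0 ?ltW.
    - by rewrite !mulr_ge0//; lra.
    - by rewrite mulr_ge0 ?ltW.
    - exact: nm.
  have Bl : B * lam <= B * L by rewrite ler_wpM2l//; lra.
  have Bl0 : 0 <= B * lam by rewrite mulr_ge0//; lra.
  have BL0 : 0 <= B * L by rewrite mulr_ge0//; lra.
  apply/andP; split; first by rewrite mulr_ge0// addr_ge0// !mulr_ge0//; lra.
  rewrite -mulrDl mulrA ler_wpM2r//; first exact: ltW.
  by rewrite /pointC; have := mulr_ge0 cB (ltW L0); nra.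
rewrite -(ler_pM2l (exprn_gt0 (2 ^ l) (mulr_gt0 lam_gt0 a0))) -ExZ; last exact/bmfX/bmf_dev.
under [X in E X]eq_fun do rewrite -exprMn.
rewrite -exprMn.
apply: (@moment_le _ _ _ P _ (fun w => `|offdiag x x (X w)|)).
- by apply: bmfZ; exact: bmf_dev.
- exact: bmf_abs_offdiag.
- move=> w; apply/andP; split; first by rewrite !mulr_ge0// ltW.
  have := dotv_mulmx x x (fun j => lamX j w); rewrite -!sqr_l2norm -/a => eq.
  have y0 := l2norm_ge0 (X w *m x).
  have -> : offdiag x x (X w) = devp lam x (X w) * (l2norm (X w *m x) + lam * a).
    rewrite /devp -/a; apply: (addrI (lam ^+ 2 * a ^+ 2)); rewrite -eq; ring.
  have la0 : 0 <= lam * a by rewrite mulr_ge0 ?ltW.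
  by rewrite normrM mulrC ler_wpM2l// [leRHS]ger0_norm; lra.
apply: moment_weaken (abs_offdiag_moment x x l0) _.
rewrite -/L -/a; apply/andP; split; first by rewrite !mulr_ge0//; lra.
have -> : c0 * L * a * (B * (lam + L) * a) = (c0 * B * (lam + L)) * (L * a * a) by ring.
have -> : lam * a * (pointC * L * a) = (pointC * lam) * (L * a * a) by ring.
apply: ler_wpM2r; first by rewrite !mulr_ge0// ltW.
apply: (@le_trans _ _ (c0 * B * (2 * lam))); first by rewrite ler_wpM2l//; lra.
rewrite /pointC; have : 0 <= B * lam by rewrite mulr_ge0//; lra.
by nra.
Qed.

(** The first term comes from [(Z x + Z y) (|A x| - |A y|)], [4 c0 B] from
    [offdiag (x - y) (x + y)], and [4 B + 2] from the case [lam < La l]. *)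
Definition incrC : R := 4 * pointC * B * theta * (1 + theta) + 4 * c0 * B + 4 * B + 2.

Lemma increment_moment l x y : (0 < l)%N ->
  E (fun w => `|devp lam x (X w) - devp lam y (X w)| ^+ (2 ^ l)) <=
  (incrC * La l * l2norm (x - y)) ^+ (2 ^ l).
Proof.
move=> l0; set L := La l; have L0 : 0 < L by exact: La_gt0.
set L' := La l.+1; have LL' : L <= L' by exact: La_nd.
have tL : L' <= theta * L by exact: La_doubling.
have t1 : 1 <= theta by rewrite -(ler_pM2r L0) mul1r (le_trans LL').
have b1 := B_ge1; have cp := c0_ge0; have lp := lam_gt0.
have cB : 0 <= c0 * B by rewrite mulr_ge0//; lra.
have C0 : 0 < pointC by rewrite /pointC; lra.
have CB0 : 0 <= pointC * B * theta * (1 + theta) by rewrite !mulr_ge0//; lra.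
have p0 : (0 < 2 ^ l)%N by rewrite expn_gt0.
have [->|xy] := eqVneq x y.
  under [X in E X]eq_fun do rewrite subrr normr0.
  by rewrite subrr l2norm0 mulr0 Ex_cst.
set a := l2norm (x - y); have a0 : 0 < a by rewrite l2norm_gt0 subr_eq0.
have bD : bmf (fun w => `|devp lam x (X w) - devp lam y (X w)|).
  by apply/bmf_norm/bmfB; apply: bmfB => //; exact: bmf_cst.
have [Ll|lL] := leP L lam; last first.
  apply: (@moment_le _ _ _ P _ (fun w => l2norm (X w *m (x - y)) + lam * a)) => //.
  - by apply: bmfD => //; exact: bmf_cst.
  - move=> w; rewrite normr_ge0/= /devp.
    rewrite (_ : _ - _ - _ = (l2norm (X w *m x) - l2norm (X w *m y)) -
      lam * (l2norm x - l2norm y)); last by ring.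
    rewrite (le_trans (ler_normB _ _))// lerD//; first by rewrite mulmxBr l2norm_dist.
    by rewrite normrM gtr0_norm// ler_wpM2l ?l2norm_dist// ltW.
  apply: (moment_weaken (a := 2 * (B * (lam + L) * a + lam * a))).
    apply: momentD => //; last by rewrite Ex_cst.
    - exact: bmf_cst.
    - by move=> w; exact: l2norm_ge0.
    - by move=> _; rewrite mulr_ge0 ?ltW.
    - by rewrite !mulr_ge0//; lra.
    - by rewrite mulr_ge0 ?ltW.
    - exact: nm.
  have Bl : B * lam <= B * L by rewrite ler_wpM2l//; lra.
  have Bl0 : 0 <= B * lam by rewrite mulr_ge0//; lra.
  have BL0 : 0 <= B * L by rewrite mulr_ge0//; lra.
  apply/andP; split; first by rewrite mulr_ge0// addr_ge0// !mulr_ge0//; lra.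
  rewrite -mulrDl mulrA ler_wpM2r//; first exact: ltW.
  rewrite /incrC; have := mulr_ge0 cB (ltW L0); have := mulr_ge0 CB0 (ltW L0); lra.
set S := l2norm x + l2norm y; have S0 : 0 < S.
  rewrite lt_neqAle addr_ge0 ?l2norm_ge0// andbT eq_sym; apply: contra xy.
  by rewrite paddr_eq0 ?l2norm_ge0// !l2norm_eq0 => /andP[/eqP -> /eqP ->].
rewrite -(ler_pM2l (exprn_gt0 (2 ^ l) (mulr_gt0 lam_gt0 S0))) -ExZ; last exact/bmfX.
under [X in E X]eq_fun do rewrite -exprMn.
rewrite -exprMn.
apply: (@moment_le _ _ _ P _ (fun w =>
    (`|devp lam x (X w)| + `|devp lam y (X w)|) * l2norm (X w *m (x - y)) +
    `|offdiag (x - y) (x + y) (X w)|)).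
- by apply: bmfZ.
- apply: bmfD; last exact: bmf_abs_offdiag.
  by apply: bmfM => //; apply: bmfD; exact: bmf_dev.
- move=> w; apply/andP; split; first by rewrite !mulr_ge0// ltW.
  have := dotv_mulmx (x - y) (x + y) (fun j => lamX j w).
  have -> : dotv (x - y) (x + y) = l2norm x ^+ 2 - l2norm y ^+ 2.
    by rewrite !sqr_l2norm !(dotvDl, dotvDr) -scaleN1r !(dotvZl, dotvZr) (dotvC y x); ring.
  have -> : dotv (X w *m (x - y)) (X w *m (x + y)) =
      l2norm (X w *m x) ^+ 2 - l2norm (X w *m y) ^+ 2.
    rewrite mulmxBr mulmxDr !sqr_l2norm !(dotvDl, dotvDr) -scaleN1r !(dotvZl, dotvZr).
    by rewrite (dotvC (X w *m y) (X w *m x)); ring.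
  move=> eq.
  have key : lam * S * (devp lam x (X w) - devp lam y (X w)) =
      - (devp lam x (X w) + devp lam y (X w)) * (l2norm (X w *m x) - l2norm (X w *m y)) +
      offdiag (x - y) (x + y) (X w).
    rewrite /devp /S; apply: (addrI (lam ^+ 2 * (l2norm x ^+ 2 - l2norm y ^+ 2))).
    rewrite [RHS]addrCA -eq; ring.
  have <- : `|lam * S| = lam * S by rewrite ger0_norm// mulr_ge0 ?ltW.
  rewrite -normrM key (le_trans (ler_normD _ _))// lerD2r normrM normrN ler_pM//.
    exact: ler_normD.
  by rewrite mulmxBr l2norm_dist.
have B0 : 0 < B by lra.
have L'0 : 0 < L' by exact: La_gt0.
have s0 : 0 < lam + L by lra.
have s'0 : 0 < lam + L' by lra.
pose q := 2 * (pointC * L' * l2norm x + pointC * L' * l2norm y) * (B * (lam + L') * a).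
pose r := c0 * L * a * (B * (lam + L) * S).
have q0 : 0 <= q.
  by rewrite /q -mulrDr -/S !mulr_ge0// ltW.
have r0 : 0 <= r by rewrite /r !mulr_ge0// ltW.
apply: (moment_weaken (a := 2 * (q + r))).
  apply: momentD => //.
  - by apply: bmfM => //; apply: bmfD; exact: bmf_dev.
  - exact: bmf_abs_offdiag.
  - by move=> w; rewrite mulr_ge0 ?addr_ge0 ?l2norm_ge0.
  (* Cauchy-Schwarz doubles the order, so both factors are estimated at level [l.+1]; [La_doubling]
     later returns to [La l] at the cost of powers of [theta]. *)
  - apply: momentM.
    + by apply: bmfD; exact: bmf_dev.
    + by [].
    + by move=> w; rewrite addr_ge0.
    + by move=> w; rewrite l2norm_ge0.
    + by rewrite -mulrDr -/S !mulr_gt0.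
    + by rewrite !mulr_gt0.
    + rewrite -mul2n -expnS; apply: momentD.
      * by rewrite expn_gt0.
      * exact: bmf_dev.
      * exact: bmf_dev.
      * by [].
      * by [].
      * by rewrite !mulr_ge0 ?l2norm_ge0// ltW.
      * by rewrite !mulr_ge0 ?l2norm_ge0// ltW.
      * exact: dev_moment.
      * exact: dev_moment.
    + by rewrite -mul2n -expnS; exact: nm.
  - apply: moment_weaken (abs_offdiag_moment (x - y) (x + y) l0) _.
    rewrite -/L -/a /r; apply/andP; split.
      by rewrite !mulr_ge0 ?l2norm_ge0// ltW.
    apply: ler_wpM2l; first by rewrite !mulr_ge0// ltW.
    by apply: ler_wpM2l; [rewrite !mulr_ge0// ltW|exact: l2normD].
rewrite mulr_ge0 ?addr_ge0//=.
have -> : lam * S * (incrC * L * a) = (incrC * L * lam) * (S * a) by ring.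
have -> : 2 * (q + r) =
    (4 * pointC * B * (L' * (lam + L')) + 2 * (c0 * B * (L * (lam + L)))) * (S * a).
  by rewrite /q /r /S; ring.
apply: ler_wpM2r; first by rewrite !mulr_ge0// ltW.
have h1 : L' * (lam + L') <= theta * (1 + theta) * (L * lam).
  have -> : theta * (1 + theta) * (L * lam) = (theta * L) * (lam + theta * lam) by ring.
  apply: ler_pM; [exact: ltW|exact: ltW|by []|rewrite lerD2l (le_trans tL)//].
  by rewrite ler_wpM2l//; lra.
have h2 : L * (lam + L) <= 2 * (L * lam) by rewrite mulrCA ler_wpM2l//; lra.
apply: (@le_trans _ _ (4 * pointC * B * (theta * (1 + theta) * (L * lam)) +
    2 * (c0 * B * (2 * (L * lam))))).
  apply: lerD; first by rewrite ler_wpM2l// !mulr_ge0// ltW.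
  by rewrite ler_wpM2l// ler_wpM2l.
have Ll0 : 0 <= L * lam by rewrite mulr_ge0// ltW.
have := mulr_ge0 (ltW B0) Ll0; rewrite /incrC => h3.
have -> : (4 * pointC * B * theta * (1 + theta) + 4 * c0 * B + 4 * B + 2) * L * lam =
  4 * pointC * B * (theta * (1 + theta) * (L * lam)) + 2 * (c0 * B * (2 * (L * lam)))
  + 4 * (B * (L * lam)) + 2 * (L * lam) by ring.
by lra.
Qed.

End chaos_moments.

(** * Generic chaining *)

Section partition_blocks.
Context {T : Type}.
Implicit Types (D : set T) (A : set (set T)).

Lemma pblock_mem D A t : partition A id D -> D t -> A (pblock A id t) /\ pblock A id t t.
Proof.
move=> [<- _ _] [B AB Bt]; rewrite /pblock /pblock_index.
by case: xgetP => [C _ []//|/(_ B)[]].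
Qed.

Lemma pblock_eq D A B t : partition A id D -> A B -> B t -> pblock A id t = B.
Proof.
move=> pA AB Bt; have Dt : D t by case: pA => <- _ _; exists B.
have [Ap pt] := pblock_mem pA Dt; case: pA => _ triv _.
by apply: (triv _ _ Ap AB); exists t.
Qed.

End partition_blocks.

Section tail_bounds.
Context {d : measure_display} {Om : measurableType d} {R : realType}.
Variable P : probability Om R.
Local Notation E := (Ex P).

Lemma measurable_gt (f : Om -> R) (s : R) : bmf f -> measurable [set w | s < f w].
Proof.
move=> [mf _]; have -> : [set w | s < f w] = setT `&` f @^-1` `]s, +oo[.
  by rewrite setTI; apply/seteqP; split => w /=; rewrite in_itv/= andbT.
exact: mf.
Qed.

(** Markov's inequality for the [p]-th power: exceeding the moment bound by a factor [e] has
    probability at most [exp (- p)]. *)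
Lemma moment_tail (f : Om -> R) (a : R) p : bmf f -> (forall w, 0 <= f w) -> 0 < a ->
  E (fun w => f w ^+ p) <= a ^+ p ->
  (P [set w | (expR 1 * a < f w)%R] <= (expR (- p%:R))%:E)%E.
Proof.
move=> bf f0 a0 fa; set S := [set w | _].
have mS : measurable S by exact: measurable_gt.
rewrite -Ex_indic// lee_fin.
have ea : 0 < expR 1 * a by rewrite mulr_gt0 ?expR_gt0.
have : (expR 1 * a) ^+ p * E \1_S <= a ^+ p.
  apply: le_trans fa; rewrite -ExZ; last exact: bmf_indic.
  apply: Ex_le; [exact/bmfZ/bmf_indic|exact: bmfX|move=> w].
  rewrite indicE; case: (boolP (w \in S)) => [|_]; last by rewrite mulr0 exprn_ge0.
  by rewrite inE mulr1 => Sw; rewrite lerXn2r ?nnegrE// ltW.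
rewrite exprMn mulrAC ger_pMl ?exprn_gt0// -expRM_natl mulr1 expRN.
by rewrite -ler_pdivlMl ?expR_gt0// mulr1.
Qed.

Lemma union_bound {T : Type} (A : set T) (F : T -> set Om) (N : nat) (e : R) :
  (A #<= `I_N)%card -> 0 <= e ->
  (forall B, measurable (F B)) -> (forall B, P (F B) <= e%:E)%E ->
  measurable (\bigcup_(B in A) F B) /\ (P (\bigcup_(B in A) F B) <= (N%:R * e)%:E)%E.
Proof.
move=> /pcard_leP/unsquash f e0 mF PF.
(* [f] numbers the members of [A] injectively, so at most one of them has number [i] and [G i] is a
   single [F B] or empty. *)
pose G i := \bigcup_(B in [set B | A B /\ f B = i]) F B.
have GE i : G i = set0 \/ exists B, G i = F B.
  have [[B [AB fB]]|nB] := pselect (exists B, A B /\ f B = i); last first.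
    by left; rewrite /G bigcup0// => B [AB fB]; exfalso; apply: nB; exists B.
  right; exists B; apply/seteqP; split => [w [C [AC fC] FC]|w FB]; last by exists B.
  suff <- : C = B by [].
  by apply: (@inj _ _ _ f); [exact/mem_set|exact/mem_set|exact: etrans fC (esym fB)].
have mG i : measurable (G i) by case: (GE i) => [->|[B ->]].
have PG i : (P (G i) <= e%:E)%E by case: (GE i) => [->|[B ->]]; rewrite ?measure0 ?lee_fin.
have -> : \bigcup_(B in A) F B = \big[setU/set0]_(i < N) G i.
  rewrite -bigcup_mkord; apply/seteqP; split => [w [B AB FB]|w [i _ [B [AB _] FB]]].
    exists (f B); last by exists B.
    by have /= := @funS _ _ _ _ f _ AB.
  by exists B.
split; first exact: bigsetU_measurable.
apply: le_trans (Boole_inequality _ _) _; first by move=> i _; exact: mG.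
apply: (@le_trans _ _ (\sum_(i < N) e%:E)%E); first by apply: lee_sum => i _; exact: PG.
by rewrite sumEFin sumr_const card_ord mulr_natl.
Qed.

End tail_bounds.

Section diameter.
Context {R : realType} {n : nat}.
Implicit Types (S T : set 'cV[R]_n).

(** A point is required: the diameter of the empty set is [-oo]. *)
Lemma l2diam_ge0 S t : S t -> (0 <= l2diam S)%E.
Proof. by move=> St; apply: ereal_sup_ubound; exists (t, t) => //=; rewrite subrr l2norm0. Qed.

Lemma l2diam_le S (r : R) : (forall t, S t -> l2norm t <= r) -> (l2diam S <= (r + r)%:E)%E.
Proof.
move=> Sr; apply: ge_ereal_sup => _ [[x y] [/= Sx Sy] <-]; rewrite lee_fin.
by rewrite (le_trans (l2normD _ _))// l2normN lerD// Sr.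
Qed.

Lemma l2diam_fin S (r : R) t : S t -> (forall t, S t -> l2norm t <= r) ->
  l2diam S \is a fin_num.
Proof.
move=> St Sr; rewrite ge0_fin_numE ?(l2diam_ge0 St)//.
exact: le_lt_trans (l2diam_le Sr) (ltry _).
Qed.

Lemma dist_le_diam S (r : R) x y : (forall t, S t -> l2norm t <= r) -> S x -> S y ->
  l2norm (x - y) <= fine (l2diam S).
Proof.
move=> Sr Sx Sy; rewrite -lee_fin fineK ?(l2diam_fin Sx Sr)//.
by apply: ereal_sup_ubound; exists (x, y).
Qed.

End diameter.

Section chaining.
Context {d : measure_display} {Om : measurableType d} {R : realType}.
Variable P : probability Om R.
Local Notation E := (Ex P).
Context {n : nat}.
Variables (alpha c : R) (Z : 'cV[R]_n -> Om -> R).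
Hypothesis alpha_gt0 : 0 < alpha.
Hypothesis c_gt0 : 0 < c.
Hypothesis bZ : forall x, bmf (Z x).
Hypothesis Z0 : forall w, Z 0 w = 0.
Hypothesis incZ : forall l x y, (0 < l)%N ->
  E (fun w => `|Z x w - Z y w| ^+ (2 ^ l)) <=
  (c * 2 `^ (l%:R / alpha) * l2norm (x - y)) ^+ (2 ^ l).
Hypothesis lipZ : forall w, exists2 L, 0 < L &
  forall x y, `|Z x w - Z y w| <= L * l2norm (x - y).

Definition weight (k : nat) : R := 2 `^ (k%:R / alpha).

Lemma weight_gt0 k : 0 < weight k.
Proof. exact: powR_gt0. Qed.

Lemma weightS k : weight k.+1 = 2 `^ alpha^-1 * weight k.
Proof.
by rewrite /weight -powRD ?pnatr_eq0 ?implybT// -(addn1 k) natrD mulrDl mul1r addrC.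
Qed.

Lemma root_ge1 : 1 <= 2 `^ alpha^-1 :> R.
Proof.
by rewrite -[leLHS](powRr0 2) ler_powR ?ler1n// invr_ge0 ltW.
Qed.

Lemma weight_ge1 k : 1 <= weight k.
Proof.
by rewrite -[leLHS](powRr0 2) ler_powR ?ler1n// divr_ge0// ltW.
Qed.

Definition inc_bad l x y : set Om :=
  [set w | expR 1 * (c * weight l * l2norm (x - y)) < `|Z x w - Z y w|].

Lemma bmf_inc x y : bmf (fun w => `|Z x w - Z y w|).
Proof. exact/bmf_norm/bmfB. Qed.

Lemma measurable_inc_bad l x y : measurable (inc_bad l x y).
Proof. exact/measurable_gt/bmf_inc. Qed.

Lemma inc_bad_prob l x y : (0 < l)%N ->
  (P (inc_bad l x y) <= (expR (- (2 ^ l)%:R))%:E)%E.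
Proof.
move=> l0; have [->|xy] := eqVneq x y.
  rewrite (_ : inc_bad _ _ _ = set0) ?measure0 ?lee_fin ?expR_ge0//.
  apply/seteqP; split => // w; rewrite /inc_bad/= !subrr l2norm0 normr0 !mulr0.
  by rewrite ltxx.
apply: (moment_tail (bmf_inc x y)) (incZ x y l0) => //.
by rewrite !mulr_gt0// ?weight_gt0// l2norm_gt0 subr_eq0.
Qed.

Variables (T : set 'cV[R]_n) (A : nat -> set (set 'cV[R]_n)) (r g : R).
Hypothesis TA : admissible T A.
Hypothesis Tr : forall t, T t -> l2norm t <= r.
Hypothesis Tg : forall t, T t ->
  (\sum_(0 <= k <oo) (2 `^ (k%:R / alpha))%:E * l2diam (pblock (A k) id t) <= g%:E)%E.

Let partA k : partition (A k) id T. Proof. by case: TA. Qed.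

Let cardA k : (A k #<= `I_(2 ^ (2 ^ k))%N)%card.
Proof.
case: TA => _ _ A0 Ak; case: k => [|k]; last exact: Ak.
by rewrite (card_le_eql A0) card_le_II.
Qed.

Definition rep (B : set 'cV[R]_n) : 'cV[R]_n := xget 0 B.

(* The chain jumps from [0] to level [l0] when [j = 0], and from level [l0 + i] to
   level [l0 + j] when [j = i.+1]. *)
Definition chain_bad l0 j : set Om :=
  if j is i.+1 then
    \bigcup_(B in A (l0 + j)%N)
      inc_bad (l0 + j).+1 (rep B) (rep (pblock (A (l0 + i)%N) id (rep B)))
  else \bigcup_(B in A l0) inc_bad l0.+1 (rep B) 0.

(** Level [k] has at most [2 ^ 2 ^ k <= exp (2 ^ k)] blocks. Testing their links at order
    [2 ^ k.+1], one level higher, leaves room for the union bound. *)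
Lemma count_exp_le k : (2 ^ (2 ^ k))%:R * expR (- (2 ^ k.+1)%:R) <= expR (- (2 ^ k)%:R) :> R.
Proof.
have e2 : 2 <= expR 1 :> R by have := expR_ge1Dx (1 : R); rewrite -[2]/(1 + 1).
have -> : expR (- (2 ^ k.+1)%:R) = expR (- (2 ^ k)%:R) * expR (- (2 ^ k)%:R) :> R.
  by rewrite -expRD expnS mul2n -addnn natrD opprD.
rewrite mulrA ler_piMl ?expR_ge0// expRN ler_pdivrMr ?expR_gt0// mul1r.
by rewrite -[X in expR X]mulr1 expRM_natl natrX lerXn2r ?nnegrE ?expR_ge0.
Qed.

(** The geometric factor comes from [2 ^ (l0 + j) >= 2 ^ l0 + j]; it makes the bounds sum over [j]
    to [2 exp (- 2 ^ l0)]. *)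
Lemma chain_bad_prob l0 j : measurable (chain_bad l0 j) /\
  (P (chain_bad l0 j) <= (2 * expR (- (2 ^ l0)%:R) / (2 ^ j.+1)%:R)%:E)%E.
Proof.
have [mb Pb] : measurable (chain_bad l0 j) /\
    (P (chain_bad l0 j) <= ((2 ^ (2 ^ (l0 + j)))%:R * expR (- (2 ^ (l0 + j).+1)%:R))%:E)%E.
  case: j => [|i] /=; rewrite ?addn0; apply: union_bound => //; rewrite ?expR_ge0//.
  - by move=> B; exact: measurable_inc_bad.
  - by move=> B; exact: inc_bad_prob.
  - by move=> B; exact: measurable_inc_bad.
  - by move=> B; exact: inc_bad_prob.
split => //; apply: le_trans Pb _; rewrite lee_fin; apply: le_trans (count_exp_le _) _.
have e2 : 2 <= expR 1 :> R by have := expR_ge1Dx (1 : R); rewrite -[2]/(1 + 1).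
apply: (@le_trans _ _ (expR (- (2 ^ l0)%:R) * expR (- j%:R))).
  rewrite -expRD ler_expR -opprD lerN2 -natrD ler_nat expnD.
  have := ltn_expl j (isT : 1 < 2)%N; have : (0 < 2 ^ l0)%N by rewrite expn_gt0.
  by move: (2 ^ l0)%N (2 ^ j)%N => a b; nia.
rewrite [2 * _]mulrC -mulrA ler_wpM2l ?expR_ge0// expnS natrM invfM mulrA divff// mul1r.
rewrite expRN lef_pV2 ?posrE ?expR_gt0 ?ltr0n ?expn_gt0//.
by rewrite -[X in expR X]mulr1 expRM_natl natrX lerXn2r ?nnegrE ?expR_ge0.
Qed.

Lemma chain_partial_sum t N : T t ->
  \sum_(0 <= k < N) weight k * fine (l2diam (pblock (A k) id t)) <= g.
Proof.
move=> Tt.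
have sub k s : pblock (A k) id t s -> l2norm s <= r.
  have [Ap _] := pblock_mem (partA k) Tt => ps; apply: Tr.
  by case: (partA k) => <- _ _; exists (pblock (A k) id t).
have mem k : pblock (A k) id t t by case: (pblock_mem (partA k) Tt).
rewrite -lee_fin -sumEFin; apply: le_trans (Tg Tt).
rewrite [X in (X <= _)%E](_ : _ =
    (\sum_(0 <= k < N) (2 `^ (k%:R / alpha))%:E * l2diam (pblock (A k) id t))%E).
  apply: nneseries_lim_ge => k _; rewrite mule_ge0 ?lee_fin ?powR_ge0//.
  exact: l2diam_ge0 (mem k).
by apply: eq_bigr => k _; rewrite EFinM fineK// (l2diam_fin (mem k) (sub k)).
Qed.

(** The jumps telescope along representatives of the blocks around [t]. A jump into level [k + 1] is
    tested at order [2 ^ (k + 2)] while its length is at most the diameter at level [k]; this lag of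
    two levels is the square of [2 ^ (1 / alpha)]. *)
Lemma chaining_path l0 w t : (forall j, ~ chain_bad l0 j w) -> T t ->
  `|Z t w| <= expR 1 * c * (2 `^ alpha^-1) ^+ 2 * (g + weight l0 * r).
Proof.
move=> good Tt; set th := 2 `^ alpha^-1; have th1 : 1 <= th := root_ge1.
pose B k := pblock (A k) id t; pose del k := fine (l2diam (B k)).
have AB k : A k (B k) by case: (pblock_mem (partA k) Tt).
have Bt k : B k t by case: (pblock_mem (partA k) Tt).
have BT k s : B k s -> T s by move=> Bs; case: (partA k) => <- _ _; exists (B k).
have Br k s : B k s -> l2norm s <= r by move=> /BT; exact: Tr.
have Brep k : B k (rep (B k)) by apply: xgetPex; exists t.
have diam k x y : B k x -> B k y -> l2norm (x - y) <= del k.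
  exact: dist_le_diam (Br k).
have del0 k : 0 <= del k.
  by apply: le_trans (diam k t t _ _); rewrite ?l2norm_ge0.
(* [chain_bad] reaches the parent block through a representative; refinement identifies it with the
   block of [t]. *)
have parent k : pblock (A k) id (rep (B k.+1)) = B k.
  have [_ ref _ _] := TA; have [B' AB' sub] := ref _ _ (AB k.+1).
  rewrite (pblock_eq (partA k) AB' (sub _ (Brep _))).
  by rewrite -(pblock_eq (partA k) AB' (sub _ (Bt _))).
have e0 : 0 < expR 1 * c by rewrite mulr_gt0 ?expR_gt0.
have start : `|Z (rep (B l0)) w| <= expR 1 * c * th ^+ 2 * (weight l0 * r).
  have /= := good 0%N; move/asboolP; rewrite asboolE => nb.
  have : ~ inc_bad l0.+1 (rep (B l0)) 0 w by move=> ib; apply: nb; exists (B l0).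
  rewrite /inc_bad/= Z0 !subr0 => /negP; rewrite -leNgt => /le_trans; apply.
  rewrite weightS -/th (_ : expR 1 * _ =
    expR 1 * c * th * (weight l0 * l2norm (rep (B l0)))); last by ring.
  have rr : l2norm (rep (B l0)) <= r by exact: Br (Brep _).
  have wr : 0 <= weight l0 * l2norm (rep (B l0)).
    by rewrite mulr_ge0 ?l2norm_ge0// ltW ?weight_gt0.
  apply: ler_pM => //.
  - by rewrite mulr_ge0// ltW// (lt_le_trans _ th1).
  - by apply: ler_wpM2l; [exact: ltW|rewrite expr2 ler_peMr// (le_trans _ th1)].
  - by rewrite ler_wpM2l// ltW ?weight_gt0.
have step i : `|Z (rep (B (l0 + i).+1)) w - Z (rep (B (l0 + i)%N)) w| <=
    expR 1 * c * th ^+ 2 * (weight (l0 + i) * del (l0 + i)%N).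
  have nb := good i.+1.
  have : ~ inc_bad (l0 + i).+2 (rep (B (l0 + i).+1)) (rep (B (l0 + i)%N)) w.
    by move=> ib; apply: nb; exists (B (l0 + i).+1); rewrite addnS// parent.
  rewrite /inc_bad/= => /negP; rewrite -leNgt => /le_trans; apply.
  rewrite !weightS -/th (_ : expR 1 * _ = expR 1 * c * th ^+ 2 *
    (weight (l0 + i) * l2norm (rep (B (l0 + i).+1) - rep (B (l0 + i)%N)))); last by ring.
  apply: ler_wpM2l; first by rewrite mulr_ge0 ?sqr_ge0// ltW.
  apply: ler_wpM2l; first by rewrite ltW ?weight_gt0.
  apply: diam => //.
  have [_ ref _ _] := TA; have [B' AB' sub] := ref _ _ (AB (l0 + i).+1).
  rewrite -[B (l0 + i)%N](_ : B' = _); first exact/sub/Brep.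
  by rewrite -(pblock_eq (partA _) AB' (sub _ (Bt _))).
pose Q := expR 1 * c * th ^+ 2.
have Q0 : 0 < Q by rewrite mulr_gt0// exprn_gt0// (lt_le_trans _ th1).
have chain N : `|Z (rep (B (l0 + N)%N)) w| <=
    Q * (weight l0 * r + \sum_(l0 <= k < l0 + N) weight k * del k).
  elim: N => [|N ih]; first by rewrite addn0 big_geq// addr0.
  rewrite addnS big_nat_recr ?leq_addr//= addrA mulrDr.
  rewrite -(subrK (Z (rep (B (l0 + N)%N)) w) (Z _ w)) (le_trans (ler_normD _ _))//.
  by rewrite [leLHS]addrC; apply: lerD => //; exact: step.
have tailsum N : \sum_(l0 <= k < l0 + N) weight k * del k <= g.
  apply: le_trans (chain_partial_sum (l0 + N) Tt).
  rewrite [leRHS](big_cat_nat (n := l0)) ?leq_addr//= lerDr sumr_ge0// => k _.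
  by apply: mulr_ge0; [exact: ltW (weight_gt0 _)|exact: del0].
(* The Lipschitz constant, which may depend on [w], handles the last link, from a representative to
   [t]. Some diameter on the path is as small as desired: otherwise their sum, with weights at least
   1, would exceed [g]. *)
have [L L0 lip] := lipZ w.
apply/ler_addgt0Pr => e ep.
have [N small] : exists N, L * del (l0 + N)%N <= e.
  apply: contrapT => nex.
  have big N : e <= L * del (l0 + N)%N.
    by apply/ltW; rewrite ltNge; apply/negP => h; apply: nex; exists N.
  pose N := (Num.truncn (L * g / e)).+1.
  have : N%:R * e <= L * g.
    apply: (@le_trans _ _ (L * \sum_(l0 <= k < l0 + N) weight k * del k)); last first.
      by rewrite ler_wpM2l ?(ltW L0).
    rewrite -{1}[l0]add0n big_addn addnC addnK mulr_sumr mulr_natl.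
    rewrite -[X in e *+ X]subn0 -sumr_const_nat; apply: ler_sum => i _.
    rewrite addnC; apply: le_trans (big i) _; rewrite ler_wpM2l ?(ltW L0)//.
    by rewrite ler_peMl// weight_ge1.
  rewrite -ler_pdivlMr// leNgt => /negP; apply.
  have g0 : 0 <= g.
    by apply: le_trans (tailsum 0%N); rewrite addn0 big_geq.
  have /truncn_itv/andP[_] : 0 <= L * g / e by rewrite divr_ge0 ?mulr_ge0 ?(ltW L0) ?(ltW ep).
  exact.
rewrite -(subrK (Z (rep (B (l0 + N)%N)) w) (Z t w)) (le_trans (ler_normD _ _))//.
rewrite addrC lerD//; last first.
  apply: le_trans (lip _ _) (le_trans _ small); rewrite ler_wpM2l ?(ltW L0)//.
  exact: diam.
by apply: le_trans (chain N) _; rewrite -/Q ler_wpM2l ?(ltW Q0)// addrC lerD2r.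
Qed.

Lemma chaining_tail l0 : exists Bad : set Om, [/\ measurable Bad,
  (P Bad <= (2 * expR (- (2 ^ l0)%:R))%:E)%E &
  forall w t, ~ Bad w -> T t ->
    `|Z t w| <= expR 1 * c * (2 `^ alpha^-1) ^+ 2 * (g + weight l0 * r)].
Proof.
have mb j : measurable (chain_bad l0 j) by case: (chain_bad_prob l0 j).
exists (\bigcup_j chain_bad l0 j); split; first exact: bigcupT_measurable.
  apply: (@le_trans _ _ (\sum_(j <oo) P (chain_bad l0 j))%E).
    by apply: generalized_Boole_inequality => //; exact: bigcupT_measurable.
  have e0 : 0 <= 2 * expR (- (2 ^ l0)%:R) :> R by rewrite mulr_ge0 ?expR_ge0.
  apply: le_trans (epsilon_trick0 xpredT e0).
  by apply: lee_nneseries => // j _; case: (chain_bad_prob l0 j).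
by move=> w t nb; apply: chaining_path => j bj; apply: nb; exists j.
Qed.

End chaining.

(** * From the psi norm to moments *)

Section psi_moments.
Context {R : realType}.

(** This is [ln x <= x] at [x = z / r], multiplied by [r]. *)
Lemma powR_le_exp (z r : R) : 0 <= z -> 0 < r -> z `^ r <= r `^ r * expR z.
Proof.
rewrite le_eqVlt => /predU1P[<-|z0] r0.
  by rewrite powR0 ?gt_eqF// mulr_ge0 ?powR_ge0 ?expR_ge0.
rewrite /powR !gt_eqF// -expRD ler_expR.
have zr : 0 < z / r by rewrite divr_gt0.
have := ltW (ln_sublinear zr); rewrite ln_div ?posrE// lerBlDr => /(ler_wpM2l (ltW r0)).
by rewrite mulrDr mulrCA divff ?gt_eqF// mulr1 addrC.
Qed.

Lemma expr_le_psi (alpha y : R) i : 0 < alpha -> 0 <= y -> (0 < i)%N ->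
  y ^+ i.*2 <= (i.*2%:R / alpha) `^ (i.*2%:R / alpha) * expR (y `^ alpha).
Proof.
move=> a0 y0 i0; have r0 : 0 < i.*2%:R / alpha by rewrite divr_gt0// ltr0n double_gt0.
apply: le_trans (powR_le_exp (powR_ge0 y alpha) r0).
by rewrite -powRrM mulrCA divff ?gt_eqF// mulr1 powR_mulrn.
Qed.

Context {d : measure_display} {Om : measurableType d}.
Variable P : probability Om R.

Lemma psi_norm_moment (alpha K K' : R) (xi : Om -> R) i :
  0 < alpha -> measurable_fun setT xi -> (psi_norm P alpha xi <= K%:E)%E ->
  K < K' -> (0 < i)%N ->
  (\int[P]_w (xi w ^+ i.*2)%:E <=
   (2 * K' ^+ i.*2 * (i.*2%:R / alpha) `^ (i.*2%:R / alpha))%:E)%E.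
Proof.
move=> a0 mxi psiK KK' i0.
(* The room between [K] and [K'] provides an admissible [t < K'] whether or not the infimum is
   attained. *)
have /ereal_inf_lt[_ [t [t0 Et] <-]] : (psi_norm P alpha xi < K'%:E)%E.
  by rewrite (le_lt_trans psiK)// lte_fin.
rewrite lte_fin => tK'.
set c := (i.*2%:R / alpha) `^ (i.*2%:R / alpha).
have c0 : 0 <= c by exact: powR_ge0.
pose h w := expR (`|xi w / t| `^ alpha).
have mh : measurable_fun setT h.
  apply: measurableT_comp => //; apply: (measurableT_comp (measurable_powR alpha)).
  by apply: measurableT_comp => //; exact: measurable_funM.
have ct0 : 0 <= t ^+ i.*2 * c by rewrite mulr_ge0// exprn_ge0// ltW.
apply: (@le_trans _ _ (\int[P]_w ((t ^+ i.*2 * c)%:E * (h w)%:E))%E).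
  apply: ge0_le_integral => //.
  - by move=> w _; rewrite lee_fin exprn_even_ge0// odd_double.
  - by apply/measurable_EFinP; exact: measurable_funX.
  - apply: measurable_funeM; exact/measurable_EFinP.
  - move=> w _; rewrite -EFinM lee_fin -mulrA.
    have -> : xi w ^+ i.*2 = t ^+ i.*2 * `|xi w / t| ^+ i.*2.
      rewrite -normrX ger0_norm ?exprn_even_ge0 ?odd_double// -exprMn mulrCA divff ?mulr1//.
      by rewrite gt_eqF.
    by rewrite ler_wpM2l ?exprn_ge0 ?(ltW t0)// expr_le_psi.
rewrite ge0_integralZl//; last 2 first.
- exact/measurable_EFinP.
- by move=> w _; rewrite lee_fin expR_ge0.
move: Et; rewrite unlock => Et.
apply: (@le_trans _ _ ((t ^+ i.*2 * c)%:E * 2%:E)%E); first by rewrite lee_wpmul2l.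
rewrite -EFinM lee_fin mulrC mulrA ler_wpM2r// ler_wpM2l//.
by rewrite lerXn2r ?nnegrE ?(ltW t0)// ltW// (lt_trans t0).
Qed.

End psi_moments.

Section scale.
Context {R : realType}.
Variable alpha : R.
Hypothesis alpha_gt0 : 0 < alpha.
Hypothesis alpha_le2 : alpha <= 2.

(** In the 4, one factor 2 pays for [K' = 2 K] and the other, raised to the power [2 i], for the
    prefactor 2 of the moment bound. *)
Definition baseC : R := 4 * alpha^-1 `^ alpha^-1.

Lemma baseC_gt0 : 0 < baseC.
Proof. by rewrite /baseC mulr_gt0// powR_gt0// invr_gt0. Qed.

(** With [s = 2 i], [s ^ (s / alpha)] is the subgaussian [s ^ i] times [s ^ (s / alpha - i)]. The
    last exponent is nonnegative, so [s] may be raised there to [2 ^ l], giving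
    [weight l ^ s / (2 ^ l) ^ i]. *)
Lemma psi_scale (K : R) l i : 0 < K -> (0 < i)%N -> (i.*2 <= 2 ^ l)%N ->
  2 * (2 * K) ^+ i.*2 * (i.*2%:R / alpha) `^ (i.*2%:R / alpha) <=
  i.*2%:R ^+ i * ((K * baseC * weight alpha l) ^+ 2 / (2 ^ l)%:R) ^+ i.
Proof.
move=> K0 i0 il; set s : R := i.*2%:R; set b := alpha^-1 `^ alpha^-1.
have s0 : 0 < s by rewrite ltr0n double_gt0.
have a1 : 0 < alpha^-1 by rewrite invr_gt0.
have b0 : 0 <= b by exact: powR_ge0.
have si : s = 2 * i%:R by rewrite /s -muln2 natrM mulrC.
have e0 : 0 <= s / alpha - i%:R.
  by rewrite subr_ge0 ler_pdivlMr// si mulrC ler_wpM2r.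
have -> : (s / alpha) `^ (s / alpha) = s ^+ i * s `^ (s / alpha - i%:R) * b ^+ i.*2.
  rewrite powRM ?(ltW s0) ?(ltW a1)//; congr (_ * _).
    rewrite -powR_mulrn ?(ltW s0)// -powRD ?(gt_eqF s0) ?implybT//.
    by rewrite addrC subrK.
  by rewrite [s / _]mulrC powRrM -/b -powR_mulrn.
have W0 : 0 < weight alpha l by exact: weight_gt0.
have sl : s `^ (s / alpha - i%:R) <= weight alpha l ^+ i.*2 / (2 ^ l)%:R ^+ i.
  apply: (@le_trans _ _ ((2 ^ l)%:R `^ (s / alpha - i%:R))).
    by apply: ge0_ler_powR => //; rewrite ?nnegrE ?(ltW s0)// ler_nat.
  rewrite natrX -powR_mulrn// -powRrM mulrBr powRB ?pnatr_eq0 ?implybT//.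
  rewrite -[in leRHS]powR_mulrn ?(ltW W0)// /weight -powRrM -!powR_mulrn ?powR_ge0//.
  by rewrite -powRrM -/s mulrAC mulrA mulrAC lexx.
rewrite -/s (_ : 2 * _ * _ =
  s ^+ i * (2 * ((2 * K) ^+ i.*2 * b ^+ i.*2 * s `^ (s / alpha - i%:R)))); last by ring.
rewrite ler_wpM2l ?exprn_ge0 ?(ltW s0)//.
have -> : ((K * baseC * weight alpha l) ^+ 2 / (2 ^ l)%:R) ^+ i =
    4 ^+ i * ((2 * K) ^+ i.*2 * b ^+ i.*2 * (weight alpha l ^+ i.*2 / (2 ^ l)%:R ^+ i)).
  rewrite /baseC -/b -!mul2n !exprM -!exprMn -exprVn -!exprMn; congr (_ ^+ i).
  by ring.
have h0 : 0 <= (2 * K) ^+ i.*2 * b ^+ i.*2.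
  by rewrite mulr_ge0 ?exprn_ge0// mulr_ge0// ltW.
apply: ler_pM => //; last by rewrite ler_wpM2l.
  by rewrite mulr_ge0 ?powR_ge0.
case: i i0 {il s si s0 e0 sl h0} => // i _; rewrite exprS.
have : 1 <= 4 ^+ i :> R by rewrite exprn_ege1// ler1n.
lra.
Qed.

End scale.

(** * Borel measurability *)

Lemma continuous_borel (V W : ptopologicalType) (f : V -> W) :
  continuous f -> measurable_fun setT (f : borel V -> borel W).
Proof.
move=> cf; apply: (@measurability _ _ (borel V) (borel W) _ _ open erefl) => _ [U oU <-].
by rewrite setTI; apply: sub_sigma_algebra; move/continuousP: cf; apply.
Qed.

Section matrix_continuity.
Context {R : realType} {m n : nat}.

Lemma continuous_col (j : 'I_n) : continuous (fun M : 'M[R]_(m, n) => col j M).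
Proof.
move=> M s /= /(nbhs_ballP (col j M)) [e e0 es]; apply/nbhs_ballP; exists e => //= N [_ MN].
by apply: es; split => // i k; rewrite !mxE; exact: MN.
Qed.

Lemma continuous_sum_fun (V : topologicalType) (I : Type) (r : seq I) (f : I -> V -> R) :
  (forall i, continuous (f i)) -> continuous (fun v => \sum_(i <- r) f i v).
Proof.
move=> cf; elim: r => [|i r ih] v.
  under eq_fun do rewrite big_nil; exact: cvg_cst.
by under eq_fun do rewrite big_cons; apply: (@continuousD _ R^o); [exact: cf|exact: ih].
Qed.

Lemma continuous_l2norm_mulmx (x : 'cV[R]_n) :
  continuous (fun M : 'M[R]_(m, n) => l2norm (M *m x)).
Proof.
have ce i : continuous (fun M : 'M[R]_(m, n) => (M *m x) i 0).
  have -> : (fun M : 'M[R]_(m, n) => (M *m x) i 0) = (fun M => \sum_j M i j * x j 0).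
    by apply/funext => M; rewrite mxE.
  apply: continuous_sum_fun => j M.
  by apply: continuousM; [exact: coord_continuous|exact: cst_continuous].
move=> M; apply: (@continuous_comp 'M[R]_(m, n) R R
  (fun M => dotv (M *m x) (M *m x)) (@Num.sqrt R)).
  by apply: continuous_sum_fun => i N; apply: continuousM; exact: ce.
exact: sqrt_continuous.
Qed.

(** A supremum of continuous functions is lower semicontinuous; this makes the deviation measurable
    for uncountable [T] too. *)
Lemma open_deviation_gt (lam : R) (T : set 'cV[R]_n) (s : R) :
  open [set M : 'M[R]_(m, n) | (s%:E < deviation lam T M)%E].
Proof.
have -> : [set M : 'M[R]_(m, n) | (s%:E < deviation lam T M)%E] =
    \bigcup_(x in T) [set M | s < `|l2norm (M *m x) - lam * l2norm x|].
  apply/seteqP; split => [M /= /ereal_sup_gt[_ [x Tx <-]]|M [x Tx] /= sx].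
    by rewrite lte_fin => sx; exists x.
  by rewrite (@lt_le_trans _ _ (`|l2norm (M *m x) - lam * l2norm x|%:E))//
    ?lte_fin//; apply: ereal_sup_ubound; exists x.
apply: bigcup_open => x _.
have cf : continuous (fun M : 'M[R]_(m, n) => `|l2norm (M *m x) - lam * l2norm x|).
  move=> M; apply: (@continuous_comp 'M[R]_(m, n) R R (fun M : 'M[R]_(m, n) =>
    l2norm (M *m x) - lam * l2norm x) (@Num.norm R R)); last exact: norm_continuous.
  by apply: (@continuousB _ R^o); [exact: continuous_l2norm_mulmx|exact: cst_continuous].
have := (continuousP _).1 cf `]s, +oo[%classic; rewrite (_ : _ @^-1` _ =
    [set M | s < `|l2norm (M *m x) - lam * l2norm x|]).
  by apply; exact: interval_open.
by apply/seteqP; split => M /=; rewrite in_itv/= andbT.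
Qed.

End matrix_continuity.

Section measurability.
Context {d : measure_display} {Om : measurableType d} {R : realType} {m n : nat}.
Variable A : Om -> 'M[R]_(m, n).
Hypothesis mA : random_matrix A.

Lemma measurable_col j : measurable_fun setT ((fun w => col j (A w)) : Om -> borel 'cV[R]_m).
Proof.
have mc := continuous_borel (@continuous_col R m n j).
exact: (measurableT_comp mc mA).
Qed.

Lemma measurable_deviation (lam : R) T :
  measurable_fun setT (fun w => deviation lam T (A w)).
Proof.
apply: (measurability _ (ErealGenOInfty.measurableE R)) => /= _ [_ [s ->]] <-.
rewrite setTI preimage_itvoy.
rewrite -[X in measurable X]setTI.
have mA' : measurable_fun setT (A : Om -> borel 'M[R]_(m, n)) := mA.
have mS : measurable ([set M | (s%:E < deviation lam T M)%E] : set (borel 'M[R]_(m, n))).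
  by apply: sub_sigma_algebra; exact: open_deviation_gt.
exact: (mA' measurableT _ mS).
Qed.

End measurability.

(** * Columns of constant norm *)

Lemma measurable_l2norm {R : realType} {m : nat} :
  measurable_fun setT (fun v : borel 'cV[R]_m => l2norm (v : 'cV[R]_m)).
Proof.
apply: continuous_borel_measurable.
have -> : (fun v : 'cV[R]_m => l2norm v) = (fun v => l2norm (v *m 1%:M)).
  by apply/funext => v; rewrite mulmx1.
exact: continuous_l2norm_mulmx.
Qed.

Lemma l2norm_sum {R : realType} {m : nat} (I : Type) (r : seq I) (F : I -> 'cV[R]_m) :
  l2norm (\sum_(i <- r) F i) <= \sum_(i <- r) l2norm (F i).
Proof.
elim/big_rec2 : _ => [|i a v _ va]; first by rewrite l2norm0.
by rewrite (le_trans (l2normD _ _))// lerD2l.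
Qed.

Section modification.
Context {d : measure_display} {Om : measurableType d} {R : realType}.
Variable P : probability Om R.
Context {m n : nat}.
Variables (A : Om -> 'M[R]_(m, n)) (lam : R).
Hypothesis mA : random_matrix A.
Hypothesis iA : mutually_independent P (fun (j : 'I_n) w => col j (A w)).
Hypothesis meanA : forall i j, 'E_P[fun w => A w i j]%E = 0%E.
Hypothesis lamA : forall j, {ae P, forall w, l2norm (col j (A w)) = lam}.

Lemma good_columns : {ae P, forall w, forall j, l2norm (col j (A w)) = lam}.
Proof. by apply: filter_forall => j; exact: lamA. Qed.

(* [v0] replaces the columns whose norm is not [lam]. *)
Variable v0 : 'cV[R]_m.
Hypothesis lamv0 : l2norm v0 = lam.

(** A measurable map acting on one column at a time, so independence of the columns survives. *)
Definition fix_col (v : 'cV[R]_m) := if l2norm v == lam then v else v0.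

Definition fix_cols w : 'M[R]_(m, n) := \matrix_(i, j) fix_col (col j (A w)) i 0.

Lemma col_fix_cols j w : col j (fix_cols w) = fix_col (col j (A w)).
Proof. by apply/colP => i; rewrite !mxE. Qed.

Lemma l2norm_fix_cols j w : l2norm (col j (fix_cols w)) = lam.
Proof. by rewrite col_fix_cols /fix_col; case: eqP. Qed.

Lemma fix_cols_id w : (forall j, l2norm (col j (A w)) = lam) -> fix_cols w = A w.
Proof. by move=> good; apply/matrixP => i j; rewrite mxE /fix_col good eqxx mxE. Qed.

Lemma fix_cols_ae : {ae P, forall w, fix_cols w = A w}.
Proof. by apply: filterS good_columns => w; exact: fix_cols_id. Qed.

Lemma measurable_fix_col :
  measurable_fun setT (fix_col : borel 'cV[R]_m -> borel 'cV[R]_m).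
Proof.
move=> _ B mB; rewrite setTI.
pose S : set (borel 'cV[R]_m) := (fun v => l2norm (v : 'cV[R]_m)) @^-1` [set lam].
have mS : measurable S.
  by rewrite -[S]setTI; apply: (@measurable_l2norm R m) => //; exact: measurable_set1.
have -> : fix_col @^-1` B = (B `&` S) `|` ((fun=> v0) @^-1` B `&` ~` S).
  apply/seteqP; split => v /=; rewrite /fix_col.
    by case: eqP => [e Bv|ne Bv0]; [left|right].
  by move=> [[Bv ->]|[Bv0 /eqP/negPf ->]]; rewrite ?eqxx.
apply: measurableU; first exact: measurableI.
apply: measurableI; last exact: measurableC.
have := @measurable_cst _ _ (borel 'cV[R]_m) (borel 'cV[R]_m) setT v0 measurableT B mB.
by rewrite setTI.
Qed.

Lemma measurable_fix_cols j :
  measurable_fun setT ((fun w => col j (fix_cols w)) : Om -> borel 'cV[R]_m).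
Proof.
have := measurableT_comp measurable_fix_col (measurable_col mA j).
by apply: eq_measurable_fun => w _ /=; rewrite col_fix_cols.
Qed.

Lemma independent_fix_cols :
  mutually_independent P (fun (j : 'I_n) w => col j (fix_cols w)).
Proof.
move=> J B mB.
have pre j : (fun w => col j (fix_cols w)) @^-1` B j =
    (fun w => col j (A w)) @^-1` (fix_col @^-1` B j).
  by apply/seteqP; split => w /=; rewrite col_fix_cols.
under eq_bigcapr do rewrite pre.
under [RHS]eq_bigr do rewrite pre.
apply: iA => j jJ; rewrite -[X in measurable X]setTI.
by apply: measurable_fix_col => //; exact: mB.
Qed.

Lemma bmf_fix_cols i j : bmf (fun w => fix_cols w i j).
Proof.
have mc : measurable_fun setT (fun v : borel 'cV[R]_m => (v : 'cV[R]_m) i 0).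
  by apply: continuous_borel_measurable; exact: coord_continuous.
split.
  have := measurableT_comp mc (measurable_fix_cols j).
  by apply: eq_measurable_fun => w _ /=; rewrite mxE.
exists lam => w; rewrite -(l2norm_fix_cols j w).
by have := coord_le_l2norm (col j (fix_cols w)) i; rewrite mxE.
Qed.

Lemma measurable_entry i j : measurable_fun setT (fun w => A w i j).
Proof.
have mc : measurable_fun setT (fun v : borel 'cV[R]_m => (v : 'cV[R]_m) i 0).
  by apply: continuous_borel_measurable; exact: coord_continuous.
have := measurableT_comp mc (measurable_col mA j).
by apply: eq_measurable_fun => w _ /=; rewrite mxE.
Qed.

Lemma mean_fix_cols i j : Ex P (fun w => fix_cols w i j) = 0.
Proof.
apply: EFin_inj; rewrite Ex_EFin; last exact: bmf_fix_cols.
apply: etrans (meanA i j); rewrite unlock; apply: ae_eq_integral => //.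
- by apply/measurable_EFinP; case: (bmf_fix_cols i j).
- by apply/measurable_EFinP; exact: measurable_entry.
- by apply: filterS fix_cols_ae => w -> _.
Qed.

Lemma psi_moment_fix_cols (alpha K K' : R) j (v : 'cV[R]_m) i :
  0 < alpha -> (psi_normv P alpha (fun w => col j (A w)) <= K%:E)%E ->
  0 < K' -> K < K' -> (0 < i)%N ->
  Ex P (fun w => dotv (col j (fix_cols w)) v ^+ i.*2) <=
  2 * K' ^+ i.*2 * (i.*2%:R / alpha) `^ (i.*2%:R / alpha) * dotv v v ^+ i.
Proof.
move=> a0 psiK K'0 KK' i0.
have i20 : i.*2 != 0%N by rewrite -lt0n double_gt0.
have [->|vn0] := eqVneq v 0.
  rewrite [X in Ex P X](_ : _ = fun=> 0) ?Ex_cst ?dotv0l ?expr0n ?gtn_eqF ?mulr0//.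
  by apply/funext => w; rewrite dotvC dotv0l expr0n (negPf i20).
have v_gt0 : 0 < l2norm v by rewrite l2norm_gt0.
pose x := (l2norm v)^-1 *: v.
have xS : unit_sphere x.
  by rewrite /unit_sphere/= l2normZ gtr0_norm ?invr_gt0// mulVf ?gt_eqF.
have bd u : bmf (fun w => dotv (col j (fix_cols w)) u).
  apply: bmf_sum => k _; apply: bmfM; last exact: bmf_cst.
  by under eq_fun do rewrite mxE; exact: bmf_fix_cols.
have md u : measurable_fun setT (fun w => dotv (col j (A w)) u).
  apply: measurable_sum => k; apply: measurable_funM => //.
  by under eq_fun do rewrite mxE; exact: measurable_entry.
have -> : (fun w => dotv (col j (fix_cols w)) v ^+ i.*2) =
    (fun w => l2norm v ^+ i.*2 * dotv (col j (fix_cols w)) x ^+ i.*2).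
  apply/funext => w; rewrite -exprMn /x dotvZr mulrA divff ?mul1r//.
  by rewrite gt_eqF.
rewrite ExZ; last exact: bmfX.
rewrite -sqr_l2norm -exprM mul2n mulrC ler_wpM2r ?exprn_ge0 ?l2norm_ge0//.
rewrite -lee_fin Ex_EFin; last exact: bmfX.
rewrite (ae_eq_integral (fun w => (dotv (col j (A w)) x ^+ i.*2)%:E))//.
- apply: (@psi_norm_moment _ _ _ _ _ K) => //; apply: (le_trans _ psiK).
  by apply: ereal_sup_ubound; exists x.
- by apply/measurable_EFinP; apply: measurable_funX; case: (bd x).
- by apply/measurable_EFinP; apply: measurable_funX.
- by apply: filterS fix_cols_ae => w -> _.
Qed.

End modification.

(** Crude and dimension dependent: it only supplies the pathwise Lipschitz constant of the
    chaining. *)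
Lemma l2norm_mulmx_le {R : realType} {m n : nat} (M : 'M[R]_(m, n)) (lam : R) x :
  (forall j, l2norm (col j M) = lam) -> l2norm (M *m x) <= lam * n%:R * l2norm x.
Proof.
move=> lamM; rewrite mulmx_sum_col (le_trans (l2norm_sum _ _))//.
apply: (@le_trans _ _ (\sum_(j < n) lam * l2norm x)).
  apply: ler_sum => j _; rewrite l2normZ lamM mulrC ler_wpM2l ?coord_le_l2norm//.
  by rewrite -(lamM j) l2norm_ge0.
by rewrite sumr_const card_ord -[leLHS]mulr_natr mulrAC.
Qed.

Lemma incrC_gt0 {R : realType} (theta : R) : 0 < theta -> 0 < incrC theta.
Proof.
move=> t0; have e0 : 0 < 4 * expR 6 :> R by rewrite mulr_gt0 ?expR_gt0.
have B0 : 0 < @normC R by rewrite /normC; lra.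
have p0 : 0 < @pointC R by rewrite /pointC; have := mulr_gt0 e0 B0; lra.
rewrite /incrC !addr_gt0 ?mulr_gt0 ?expR_gt0//; lra.
Qed.

(** * Tail of the deviation *)

Section deviation_tail.
Context {d : measure_display} {Om : measurableType d} {R : realType}.
Variable P : probability Om R.
Context {m n : nat}.
Variables (A : Om -> 'M[R]_(m, n)) (lam alpha K : R).
Hypothesis alpha_gt0 : 0 < alpha.
Hypothesis alpha_le2 : alpha <= 2.
Hypothesis lam_gt0 : 0 < lam.
Hypothesis mA : random_matrix A.
Hypothesis iA : mutually_independent P (fun (j : 'I_n) w => col j (A w)).
Hypothesis meanA : forall i j, 'E_P[fun w => A w i j]%E = 0%E.
Hypothesis lamA : forall j, {ae P, forall w, l2norm (col j (A w)) = lam}.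
Hypothesis psiA : forall j, (psi_normv P alpha (fun w => col j (A w)) <= K%:E)%E.
Variable j0 : 'I_n.

(** Supplies the replacement column [v0]: what holds almost surely holds somewhere. *)
Lemma exists_good_sample : exists w, l2norm (col j0 (A w)) = lam.
Proof.
apply: contrapT => nex; have [N [mN N0 sub]] := lamA j0.
have : P N = 1%E.
  rewrite (_ : N = setT) ?probability_setT//; apply/seteqP; split => // w _.
  by apply: sub => /= e; apply: nex; exists w.
by rewrite N0 => /eqP; rewrite eqe eq_sym oner_eq0.
Qed.

(** If [K <= 0], the second moment bound is available for every [K' > 0]; summed over the
    coordinates of a column of norm [lam], it fails for small [K']. *)
Lemma psi_bound_gt0 : 0 < K.
Proof.
rewrite ltNge; apply/negP => K0; have [w0 lamv0] := exists_good_sample.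
set v0 := col j0 (A w0) in lamv0; pose X := fix_cols A lam v0.
pose c : R := (2 / alpha) `^ (2 / alpha).
have c0 : 0 <= c by exact: powR_ge0.
(* With [K' <= 1] and [K' <= lam ^ 2 / D], the sum [2 m c K' ^ 2] of the second moment bounds is
   below [lam ^ 2]; the [+ 1] keeps [D] positive. *)
pose D : R := 4 * (m%:R * c + 1).
have D0 : 0 < D by rewrite mulr_gt0// ltr_wpDl// mulr_ge0.
pose K' := Num.min 1 (lam ^+ 2 / D).
have K'0 : 0 < K' by rewrite /K' lt_min ltr01 divr_gt0// exprn_gt0.
have K'1 : K' <= 1 by rewrite /K' ge_min lexx.
have K'D : K' * D <= lam ^+ 2 by rewrite -ler_pdivlMr// /K' ge_min lexx orbT.
have bX i : bmf (fun w => X w i j0) by exact: bmf_fix_cols.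
have coordE (i : 'I_m) (v : 'cV[R]_m) : dotv v (delta_mx i 0) = v i 0.
  rewrite /dotv (bigD1 i)//= mxE !eqxx mulr1 big1 ?addr0// => k /negPf ki.
  by rewrite mxE ki mulr0.
have mom i : Ex P (fun w => X w i j0 ^+ 2) <= 2 * K' ^+ 2 * c.
  have := psi_moment_fix_cols mA lamA lamv0 (delta_mx i 0 : 'cV[R]_m) alpha_gt0 (psiA j0)
    K'0 (le_lt_trans K0 K'0) (isT : (0 < 1)%N).
  rewrite coordE mxE !eqxx expr1 mulr1; apply: le_trans.
  rewrite le_eqVlt; apply/orP; left; apply/eqP; congr (Ex P _); apply/funext => w.
  by rewrite coordE; congr (_ ^+ _); rewrite [RHS]mxE.
have : lam ^+ 2 <= m%:R * (2 * K' ^+ 2 * c).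
  have -> : lam ^+ 2 = Ex P (fun w => \sum_(i < m) X w i j0 ^+ 2).
    rewrite -[LHS](Ex_cst P); congr (Ex P _); apply/funext => w.
    rewrite -(l2norm_fix_cols A lamv0 j0 w) sqr_l2norm; apply: eq_bigr => i _.
    by rewrite mxE expr2.
  rewrite Ex_sum => [|i _]; last exact: bmfX.
  rewrite mulr_natl -[X in _ *+ X]card_ord -sumr_const.
  by apply: ler_sum => i _; exact: mom.
have mc : 0 <= m%:R * c by rewrite mulr_ge0.
have : K' ^+ 2 * (m%:R * c) <= K' * (m%:R * c).
  by rewrite ler_wpM2r// expr2 ler_piMl// ltW.
have -> : m%:R * (2 * K' ^+ 2 * c) = 2 * (K' ^+ 2 * (m%:R * c)) by ring.
have : K' * D = 4 * (K' * (m%:R * c)) + 4 * K' by rewrite /D; ring.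
by have : 0 < lam ^+ 2 by [rewrite exprn_gt0]; lra.
Qed.

Definition tailC : R := expR 1 * (incrC (2 `^ alpha^-1) * baseC alpha) * 2 `^ alpha^-1 ^+ 2.

Lemma tailC_gt0 : 0 < tailC.
Proof.
have t0 : 0 < 2 `^ alpha^-1 :> R by exact: powR_gt0.
apply: mulr_gt0; last exact: exprn_gt0.
by apply: mulr_gt0; [exact: expR_gt0|apply: mulr_gt0; [exact: incrC_gt0|exact: baseC_gt0]].
Qed.

Variables (T : set 'cV[R]_n) (Adm : nat -> set (set 'cV[R]_n)) (r g : R).
Hypothesis TA : admissible T Adm.
Hypothesis Tr : forall t, T t -> l2norm t <= r.
Hypothesis Tg : forall t, T t ->
  (\sum_(0 <= k <oo) (2 `^ (k%:R / alpha))%:E * l2diam (pblock (Adm k) id t) <= g%:E)%E.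

Lemma deviation_tail l0 : exists Bad : set Om, [/\ measurable Bad,
  (P Bad <= (2 * expR (- (2 ^ l0)%:R))%:E)%E &
  forall w, ~ Bad w ->
    (deviation lam T (A w) <= (K * tailC * (g + weight alpha l0 * r))%:E)%E].
Proof.
have K0 := psi_bound_gt0; have [w0 lamv0] := exists_good_sample.
set v0 := col j0 (A w0) in lamv0; pose X := fix_cols A lam v0.
pose La l := K * baseC alpha * weight alpha l.
have b0 := baseC_gt0 alpha_gt0.
have La0 l : 0 < La l by apply: mulr_gt0; [exact: mulr_gt0|exact: weight_gt0].
have th1 := root_ge1 alpha_gt0.
have LaS l : La l.+1 = 2 `^ alpha^-1 * La l by rewrite /La weightS; ring.
have lamX := l2norm_fix_cols A lamv0.
have mX := measurable_fix_cols lam mA v0.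
have iX := independent_fix_cols lam iA v0.
have meanX i j := mean_fix_cols mA meanA lamA lamv0 i j.
have momX l j v i : (0 < i)%N -> (i.*2 <= 2 ^ l)%N ->
    Ex P (fun w => dotv (col j (X w)) v ^+ i.*2) <=
    i.*2%:R ^+ i * (La l ^+ 2 / (2 ^ l)%:R * dotv v v) ^+ i.
  move=> i0 il.
  have K20 : 0 < 2 * K by rewrite mulr_gt0.
  have KK : K < 2 * K by lra.
  apply: le_trans (psi_moment_fix_cols mA lamA lamv0 v alpha_gt0 (psiA j) K20 KK i0) _.
  rewrite [(_ / _ * _) ^+ i]exprMn mulrA ler_wpM2r ?exprn_ge0 ?dotv_ge0//.
  exact: psi_scale.
have Lnd l : La l <= La l.+1 by rewrite LaS ler_peMl// ltW.
have Ldb l : La l.+1 <= 2 `^ alpha^-1 * La l by rewrite LaS.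
pose c := incrC (2 `^ alpha^-1) * (K * baseC alpha).
have c_gt0 : 0 < c.
  by apply: mulr_gt0; [apply: incrC_gt0; exact: powR_gt0|exact: mulr_gt0].
pose Z x w := devp lam x (X w).
have bZ x : bmf (Z x).
  by apply: bmfB; [exact: bmf_l2norm|exact: bmf_cst].
have Z0 w : Z 0 w = 0 by rewrite /Z /devp mulmx0 !l2norm0 mulr0 subrr.
have incZ l x y : (0 < l)%N -> Ex P (fun w => `|Z x w - Z y w| ^+ (2 ^ l)) <=
    (c * 2 `^ (l%:R / alpha) * l2norm (x - y)) ^+ (2 ^ l).
  move=> l_gt0.
  have := increment_moment mX iX lamX meanX La0 momX lam_gt0 Lnd Ldb x y l_gt0.
  by rewrite /c /La !mulrA.
have lipZ w : exists2 L, 0 < L & forall x y, `|Z x w - Z y w| <= L * l2norm (x - y).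
  exists (lam * n%:R + lam); first by rewrite ltr_wpDl// mulr_ge0// ltW.
  move=> x y; rewrite /Z /devp.
  rewrite (_ : _ - _ - _ = (l2norm (X w *m x) - l2norm (X w *m y)) -
    lam * (l2norm x - l2norm y)); last by ring.
  rewrite (le_trans (ler_normB _ _))// mulrDl lerD//.
    apply: le_trans (l2norm_dist _ _) _; rewrite -mulmxBr.
    by apply: l2norm_mulmx_le => j; exact: lamX.
  by rewrite normrM gtr0_norm// ler_wpM2l ?l2norm_dist// ltW.
have [Bad [mBad PBad good]] :=
  chaining_tail alpha_gt0 c_gt0 bZ Z0 incZ lipZ TA Tr Tg l0.
have [N [mN N0 subN]] := fix_cols_ae lamA v0.
(* [N] is a null set off which the modified matrix equals [A]. *)
exists (Bad `|` N); split.
- exact: measurableU.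
- apply: le_trans (measureU2 _ _ _) _ => //.
  rewrite [X in (_ + X <= _)%E](_ : _ = 0%E); [by rewrite adde0|exact: N0].
- move=> w /not_orP[nB nN].
  have XA : X w = A w by apply: contrapT => XA; apply: nN; exact: subN.
  apply: ge_ereal_sup => _ [t Tt <-]; rewrite lee_fin.
  have := good w t nB Tt; rewrite /Z /devp XA => /le_trans; apply.
  rewrite le_eqVlt; apply/orP; left; apply/eqP.
  by rewrite /tailC /c; ring.
Qed.

End deviation_tail.

(** * The functional gamma and the expectation bound *)

Section gamma.
Context {R : realType} {n : nat}.
Variables (alpha : R) (T : set 'cV[R]_n).
Implicit Types (A : nat -> set (set 'cV[R]_n)).

Lemma pblock0 A t : admissible T A -> T t -> pblock (A 0%N) id t = T.
Proof.
move=> [pA _ A0 _] Tt; apply/seteqP; split => s.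
  move=> ps; have [Ap _] := pblock_mem (pA 0%N) Tt.
  by case: (pA 0%N) => <- _ _; exists (pblock (A 0%N) id t).
move=> Ts; have [As ss] := pblock_mem (pA 0%N) Ts; have [At tt] := pblock_mem (pA 0%N) Tt.
suff -> : pblock (A 0%N) id t = pblock (A 0%N) id s by [].
have /pcard_leP/unsquash f : (A 0%N #<= `I_1)%card by rewrite (card_le_eql A0) card_lexx.
apply: (@inj _ _ _ f); [exact/mem_set|exact/mem_set|].
have := @funS _ _ _ _ f _ At; have := @funS _ _ _ _ f _ As.
by rewrite /= !ltnS !leqn0 => /eqP -> /eqP ->.
Qed.

Lemma l2diam_subset (S : set 'cV[R]_n) : S `<=` T -> (l2diam S <= l2diam T)%E.
Proof.
move=> ST; apply: ge_ereal_sup => _ [[x y] [/= Sx Sy] <-].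
by apply: ereal_sup_ubound; exists (x, y) => //=; split; exact: ST.
Qed.

Definition chain_value A : \bar R := ereal_sup
  [set (\sum_(0 <= k <oo) (2 `^ (k%:R / alpha))%:E *
          l2diam (pblock (A k) id t))%E | t in T].

Variable t0 : 'cV[R]_n.
Hypothesis Tt0 : T t0.

Lemma pblock_sub A k t : admissible T A -> T t -> pblock (A k) id t `<=` T.
Proof.
move=> [pA _ _ _] Tt s ps; have [Ap _] := pblock_mem (pA k) Tt.
by case: (pA k) => <- _ _; exists (pblock (A k) id t).
Qed.

Lemma pblock_refl A k t : admissible T A -> T t -> pblock (A k) id t t.
Proof. by move=> [pA _ _ _] Tt; case: (pblock_mem (pA k) Tt). Qed.

(** The term [k = 0] has weight 1 and block [T]. *)
Lemma l2diam_le_chain_value A : admissible T A -> (l2diam T <= chain_value A)%E.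
Proof.
move=> TA; pose F k := ((2 `^ (k%:R / alpha))%:E * l2diam (pblock (A k) id t0))%E.
apply: (@le_trans _ _ (\sum_(0 <= k <oo) F k)%E); last first.
  by apply: ereal_sup_ubound; exists t0.
apply: le_trans (@nneseries_lim_ge _ F xpredT 0 1 _); last first.
  move=> k _ _; rewrite mule_ge0 ?lee_fin ?powR_ge0//.
  by apply: l2diam_ge0; exact: pblock_refl.
by rewrite big_nat1 /F mul0r powRr0 mul1e (pblock0 TA Tt0).
Qed.

Lemma l2diam_le_gamma : (l2diam T <= talagrand_gamma alpha T)%E.
Proof. by apply: le_ereal_inf_tmp => _ [A TA <-]; exact: l2diam_le_chain_value. Qed.

Lemma talagrand_gamma_ge0 : (0 <= talagrand_gamma alpha T)%E.
Proof. exact: le_trans (l2diam_ge0 Tt0) l2diam_le_gamma. Qed.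

Lemma near_optimal : (talagrand_gamma alpha T < +oo)%E ->
  exists A, exists g : R, [/\ admissible T A,
    forall t, T t -> (\sum_(0 <= k <oo) (2 `^ (k%:R / alpha))%:E *
          l2diam (pblock (A k) id t) <= g%:E)%E,
    0 <= g & (g%:E <= 2%:E * talagrand_gamma alpha T)%E].
Proof.
move=> gfin; have g0 := talagrand_gamma_ge0.
(* The factor 2 leaves no room when [gamma = 0], but then [T] has diameter 0. *)
have [/eqP D0|D0] := boolP (l2diam T == 0%E).
  have [_ [A TA _] _] := ereal_inf_lt gfin.
  exists A, 0; split => //; last by rewrite mule_ge0.
  move=> t Tt; rewrite eseries0// => k _ _.
  suff -> : l2diam (pblock (A k) id t) = 0%E by rewrite mule0.
  apply/eqP; rewrite eq_le -{1}D0 l2diam_subset/=; last exact: pblock_sub.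
  by apply: l2diam_ge0; exact: pblock_refl.
have gp : (0 < talagrand_gamma alpha T)%E.
  by rewrite (lt_le_trans _ l2diam_le_gamma)// lt0e D0 (l2diam_ge0 Tt0).
have gE : talagrand_gamma alpha T = (fine (talagrand_gamma alpha T))%:E.
  by rewrite fineK// ge0_fin_numE.
move: gp; rewrite {1}gE lte_fin => gp.
have : (talagrand_gamma alpha T < (2 * fine (talagrand_gamma alpha T))%:E)%E.
  by rewrite {1}gE lte_fin; lra.
move=> /ereal_inf_lt[_ [A TA <-] /ltW val].
exists A, (2 * fine (talagrand_gamma alpha T)); split => //.
- by move=> t Tt; apply: le_trans val; apply: ereal_sup_ubound; exists t.
- by rewrite mulr_ge0// ltW.
- by rewrite [in leRHS]gE EFinM.
Qed.

End gamma.

(** * From tails to expectations *)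

Section layers.
Context {d : measure_display} {Om : measurableType d} {R : realType}.
Variable P : probability Om R.
Local Open Scope ereal_scope.

(** Pointwise, if [N] is the least index with [D w <= b N], then either [N = 0] or the layer [N - 1]
    contributes [b N]. If there is none, every layer contributes at least [e > 0] and the series is
    infinite. *)
Lemma integral_le_layers (D : Om -> \bar R) (b : nat -> R) (e : R) :
  measurable_fun setT D -> (forall w, 0 <= D w) -> (0 < e)%R -> (forall l, e <= b l)%R ->
  \int[P]_w D w <=
  (b 0%N)%:E + \sum_(0 <= l <oo) (b l.+1)%:E * P [set w | (b l)%:E < D w].
Proof.
move=> mD D0 e0 eb; have b0 l : (0 <= b l)%R by exact: le_trans (ltW e0) (eb l).
pose S l := [set w | (b l)%:E < D w].
have mS l : measurable (S l).
  by rewrite /S -[X in measurable X]setTI; exact: emeasurable_fun_o_infty.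
pose f l w := ((b l.+1) * \1_(S l) w)%:E.
have f0 l w : 0 <= f l w by rewrite lee_fin mulr_ge0.
have mf l : measurable_fun setT (f l).
  by apply/measurable_EFinP; apply: measurable_funM => //; exact: measurable_indic.
have fE l w : S l w -> f l w = (b l.+1)%:E by move=> Sw; rewrite /f indicE mem_set// mulr1.
have partial w N : \sum_(0 <= l < N) f l w <= \sum_(0 <= l <oo) f l w.
  by apply: nneseries_lim_ge.
have point w : D w <= (b 0%N)%:E + \sum_(0 <= l <oo) f l w.
  have s0 : 0 <= \sum_(0 <= l <oo) f l w by apply: nneseries_ge0.
  have [ex|nex] := pselect (exists N, D w <= (b N)%:E).
    case: (ex_minnP ex) => -[Db _|N DbN min].
      by rewrite (le_trans Db)// leeDl.
    have SN : S N w.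
      by rewrite /S/= ltNge; apply/negP => /min; rewrite ltnn.
    rewrite (le_trans DbN)// -(fE _ _ SN) (le_trans _ (leeDr _ _)) ?lee_fin//.
    apply: le_trans (partial w N.+1); rewrite big_nat_recr//= leeDr//.
    exact: sume_ge0.
  have Sw l : S l w by rewrite /S/= ltNge; apply/negP => Db; apply: nex; exists l.
  suff -> : \sum_(0 <= l <oo) f l w = +oo by rewrite addey ?leey// ltNyr.
  apply/eqyP => a a0.
  have a1 : (a <= (Num.truncn (a / e)).+1%:R * e)%R.
    by rewrite -ler_pdivrMr// ltW// truncnS_gt.
  apply: le_trans (partial w (Num.truncn (a / e)).+1).
  rewrite (le_trans (_ : _ <= ((Num.truncn (a / e)).+1%:R * e)%:E)) ?lee_fin//.
  rewrite mulr_natl -[X in (e *+ X)%R]subn0 -sumr_const_nat -sumEFin.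
  by apply: lee_sum => l _; rewrite fE// lee_fin.
apply: (@le_trans _ _ (\int[P]_w ((b 0%N)%:E + \sum_(0 <= l <oo) f l w))).
  apply: ge0_le_integral => //.
  by apply: emeasurable_funD => //; exact: ge0_emeasurable_sum.
rewrite ge0_integralD//; last 2 first.
- by move=> w _; apply: nneseries_ge0.
- exact: ge0_emeasurable_sum.
rewrite integral_cst// [X in _ * X](_ : _ = 1) ?mule1; last exact: probability_setT.
rewrite leeD2l// integral_nneseries//; apply: lee_nneseries => l _.
  by move=> _; apply: integral_ge0.
rewrite /f; under eq_integral do rewrite EFinM.
rewrite ge0_integralZl ?lee_fin//; first by rewrite integral_indic ?setIT.
- exact/measurable_EFinP/measurable_indic.
- by move=> w _; rewrite lee_fin.
Qed.

End layers.

Section weight_series.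
Context {R : realType}.
Variable alpha : R.
Hypothesis alpha_gt0 : 0 < alpha.

(** With [r = 1 / alpha + 1] and [z = 2 ^ l], [powR_le_exp] gives
    [weight l * z = z ^ r <= r ^ r exp z], so the series is dominated by a geometric one. *)
Definition serC : R := 4 * 2 `^ alpha^-1 * (alpha^-1 + 1) `^ (alpha^-1 + 1).

Lemma serC_ge0 : 0 <= serC.
Proof. by rewrite /serC !mulr_ge0 ?powR_ge0. Qed.

Lemma weight_series :
  (\sum_(0 <= l <oo) (2 * weight alpha l.+1 * expR (- (2 ^ l)%:R))%:E <= serC%:E)%E.
Proof.
apply: le_trans (epsilon_trick0 xpredT serC_ge0).
apply: lee_nneseries => l _.
  by rewrite lee_fin !mulr_ge0 ?expR_ge0// ltW// weight_gt0.
rewrite lee_fin weightS; set z : R := (2 ^ l)%:R; set r := alpha^-1 + 1.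
have z0 : 0 < z by rewrite ltr0n expn_gt0.
have r0 : 0 < r by rewrite /r addr_gt0 ?invr_gt0.
have wz : weight alpha l * z = z `^ r.
  rewrite /r powRD ?gt_eqF ?implybT// powRr1 ?(ltW z0)//; congr (_ * _).
  by rewrite /z natrX -powR_mulrn// -powRrM.
have we : weight alpha l * expR (- z) <= r `^ r / z.
  rewrite ler_pdivlMr// mulrAC wz expRN ler_pdivrMr ?expR_gt0//.
  exact: powR_le_exp (ltW z0) r0.
have -> : serC / (2 ^ l.+1)%:R = 2 * 2 `^ alpha^-1 * (r `^ r / z).
  by rewrite /serC -/r expnS natrM -/z; field; rewrite gt_eqF.
have -> : 2 * (2 `^ alpha^-1 * weight alpha l) * expR (- z) =
  2 * 2 `^ alpha^-1 * (weight alpha l * expR (- z)) by ring.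
by rewrite ler_wpM2l// mulr_ge0 ?powR_ge0.
Qed.

End weight_series.

(** * Conclusion *)

Lemma rad_finite {R : realType} {n : nat} (T : set 'cV[R]_n) t0 : T t0 -> l2bounded T ->
  exists r : R, [/\ rad T = r%:E, 0 <= r & forall t, T t -> l2norm t <= r].
Proof.
move=> Tt0 [M TM]; have lb t : T t -> ((l2norm t)%:E <= rad T)%E.
  by move=> Tt; apply: ereal_sup_ubound; exists t.
have ub : (rad T <= M%:E)%E by apply: ge_ereal_sup => _ [t Tt <-]; rewrite lee_fin TM.
have fr : rad T \is a fin_num.
  rewrite ge0_fin_numE ?(le_lt_trans ub (ltry _))//.
  by apply: le_trans (lb _ Tt0); rewrite lee_fin l2norm_ge0.
exists (fine (rad T)); rewrite fineK//; split => //.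
  by rewrite fine_ge0//; apply: le_trans (lb _ Tt0); rewrite lee_fin l2norm_ge0.
by move=> t Tt; rewrite -lee_fin fineK// lb.
Qed.

Lemma deviation_ge0 {R : realType} {m n : nat} (lam : R) (T : set 'cV[R]_n) t0
  (M : 'M[R]_(m, n)) : T t0 -> (0 <= deviation lam T M)%E.
Proof.
move=> Tt0; apply: (@le_trans _ _ `|l2norm (M *m t0) - lam * l2norm t0|%:E).
  by rewrite lee_fin.
by apply: ereal_sup_ubound; exists t0.
Qed.

Lemma deviation_singleton0 {R : realType} {m n : nat} (lam : R) (T : set 'cV[R]_n)
  (M : 'M[R]_(m, n)) : (forall t, T t -> t = 0) -> (deviation lam T M <= 0)%E.
Proof.
move=> T0; apply: ge_ereal_sup => _ [t /T0 -> <-].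
by rewrite mulmx0 !l2norm0 mulr0 subrr normr0.
Qed.

Lemma gamma_dim0 {R : realType} (alpha : R) (T : set 'cV[R]_0) t0 : T t0 ->
  talagrand_gamma alpha T = 0%E.
Proof.
move=> Tt0; apply/eqP; rewrite eq_le (talagrand_gamma_ge0 alpha Tt0) andbT.
pose A (k : nat) : set (set 'cV[R]_0) := [set T].
have TA : admissible T A.
  split.
  - move=> k; split; first by rewrite /cover bigcup_set1.
      by move=> B C -> ->.
    by move=> B ->; exists t0.
  - by move=> k B ->; exists T.
  - exact: card_set1.
  - by move=> k _; rewrite (card_le_eql card_set1) card_le_II expn_gt0.
apply: le_trans (ereal_inf_lbound _) _; first by exists A.
apply: ge_ereal_sup => _ [t Tt <-]; rewrite eseries0// => k _ _.
suff -> : l2diam (pblock (A k) id t) = 0%E by rewrite mule0.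
apply/eqP; rewrite eq_le (l2diam_ge0 (pblock_refl k TA Tt)) andbT.
by apply: ge_ereal_sup => _ [[x y] _ <-]; rewrite /= (flatmx0 (x - y)) l2norm0.
Qed.

Lemma probability_ge_of_bad {d : measure_display} {Om : measurableType d} {R : realType}
    (P : probability Om R) (Bad S : set Om) (e : R) :
  measurable Bad -> measurable S -> (P Bad <= e%:E)%E -> ~` Bad `<=` S ->
  ((1 - e)%:E <= P S)%E.
Proof.
move=> mB mS Pe sub; apply: (@le_trans _ _ (P (~` Bad))); last first.
  by apply: le_measure => //; rewrite inE//; exact: measurableC.
by rewrite probability_setC// EFinB leeB.
Qed.

Lemma pow2_between {R : realType} (x : R) : 1 <= x ->
  exists l : nat, x <= (2 ^ l)%:R <= 2 * x.
Proof.
move=> x1; have ex : exists l, x <= (2 ^ l)%:R.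
  exists (Num.truncn x).+1; apply: (@le_trans _ _ (Num.truncn x).+1%:R).
    by rewrite ltW// truncnS_gt.
  by rewrite ler_nat ltnW// ltn_expl.
case: (ex_minnP ex) => -[x0 _|l xl min].
  by exists 0%N; rewrite x0 expn0/=; lra.
exists l.+1; rewrite xl/= expnS natrM ler_pM2l// ltW// ltNge.
by apply/negP => /min; rewrite ltnn.
Qed.

Section conclusion.
Context {d : measure_display} {Om : measurableType d} {R : realType}.
Variable P : probability Om R.
Context {m n : nat}.
Variables (A : Om -> 'M[R]_(m, n)) (lam alpha K : R) (T : set 'cV[R]_n).
Hypothesis alpha_gt0 : 0 < alpha.
Hypothesis mA : random_matrix A.

(** The 2 pays for a chain that is only nearly optimal; in the sum, [2 ^ (1 / alpha)] serves the
    tail and [1 + serC alpha] the expectation. *)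
Definition mainC : R := 2 * tailC alpha * (2 `^ alpha^-1 + 1 + serC alpha).

Lemma mainC_gt0 : 0 < mainC.
Proof.
have := tailC_gt0 alpha_gt0; have := serC_ge0 alpha; have := root_ge1 alpha_gt0.
by move=> h1 h2 h3; rewrite /mainC; apply: mulr_gt0; [exact: mulr_gt0|lra].
Qed.

Variables (t0 : 'cV[R]_n) (r g : R).
Hypothesis Tt0 : T t0.
Hypothesis K_gt0 : 0 < K.
Hypothesis r_ge0 : 0 <= r.
Hypothesis g_ge0 : 0 <= g.
Hypothesis Tr : forall t, T t -> l2norm t <= r.
Hypothesis tail : forall l0, exists Bad : set Om, [/\ measurable Bad,
  (P Bad <= (2 * expR (- (2 ^ l0)%:R))%:E)%E &
  forall w, ~ Bad w ->
    (deviation lam T (A w) <= (K * tailC alpha * (g + weight alpha l0 * r))%:E)%E].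

Let Q := K * tailC alpha.
Let Q_gt0 : 0 < Q.
Proof. by apply: mulr_gt0 => //; exact: tailC_gt0. Qed.

Let mdev : measurable_fun setT (fun w => deviation lam T (A w)).
Proof. exact: measurable_deviation. Qed.

(** Taking [u ^ alpha <= 2 ^ l <= 2 u ^ alpha], the lower bound controls the probability and the
    upper one gives [weight l <= 2 ^ (1 / alpha) u]. *)
Lemma deviation_probability (u : R) : 1 <= u ->
  ((1 - 2 * expR (- (u `^ alpha)))%R%:E <=
   P [set w | (deviation lam T (A w) <= (Q * 2 `^ alpha^-1 * (g + u * r))%:E)%E])%E.
Proof.
move=> u1; have u0 : 0 <= u by lra.
have ua1 : 1 <= u `^ alpha by rewrite -(powRr0 u) ler_powR// ltW.
have [l /andP[ul lu]] := pow2_between ua1.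
have [Bad [mB PB good]] := tail l.
have wu : weight alpha l <= 2 `^ alpha^-1 * u.
  have -> : weight alpha l = (2 ^ l)%:R `^ alpha^-1.
    by rewrite natrX -powR_mulrn// -powRrM.
  apply: (@le_trans _ _ ((2 * u `^ alpha) `^ alpha^-1)).
    by apply: ge0_ler_powR; rewrite ?invr_ge0 ?nnegrE ?mulr_ge0 ?powR_ge0// ltW.
  by rewrite powRM ?powR_ge0// -powRrM divff ?gt_eqF// powRr1.
apply: (probability_ge_of_bad mB).
- rewrite -[X in measurable X]setTI; exact: emeasurable_fun_infty_c.
- apply: le_trans PB _; rewrite lee_fin ler_wpM2l// ler_expR lerN2//.
- move=> w /= /good /le_trans; apply; rewrite lee_fin -/Q -mulrA ler_wpM2l ?(ltW Q_gt0)//.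
  have th := root_ge1 alpha_gt0.
  rewrite mulrDr lerD//; first by rewrite ler_peMl.
  by rewrite mulrA ler_wpM2r.
Qed.

Lemma deviation_expectation :
  (\int[P]_w deviation lam T (A w) <= (Q * (1 + serC alpha) * (g + r))%:E)%E.
Proof.
have s0 := serC_ge0 alpha.
have dev0 w : (0 <= deviation lam T (A w))%E by exact: deviation_ge0 Tt0.
(* The layers need the positive lower bound [Q * r]; when [r = 0], [T] contains only [0] and the
   deviation vanishes. *)
move: r_ge0; rewrite le_eqVlt => /predU1P[r0|r_gt0].
  rewrite (eq_integral (cst 0%E)) => [|w _].
    rewrite integral_cst// mul0e lee_fin mulr_ge0//; last by rewrite -r0 addr0.
    by rewrite mulr_ge0 ?(ltW Q_gt0)// addr_ge0.
  apply/eqP; rewrite eq_le dev0 andbT; apply: deviation_singleton0 => t /Tr.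
  by rewrite -r0 => t_le; apply/eqP; rewrite -l2norm_eq0 eq_le t_le l2norm_ge0.
pose b l := Q * (g + weight alpha l * r).
have w1 l := weight_ge1 alpha_gt0 l.
have gr : 0 < g + r by rewrite ltr_wpDl.
have bQ l : Q * r <= b l.
  apply: ler_wpM2l; first exact: ltW.
  by have := ler_wpM2r (ltW r_gt0) (w1 l); rewrite mul1r; move: g_ge0; lra.
have Qr : 0 < Q * r by exact: mulr_gt0.
apply: le_trans (integral_le_layers P mdev dev0 Qr bQ) _.
have -> : b 0%N = Q * (g + r) by rewrite /b /weight mul0r powRr0 mul1r.
have -> : Q * (1 + serC alpha) * (g + r) = Q * (g + r) + Q * (g + r) * serC alpha by ring.
rewrite EFinD leeD2l// [in leRHS]EFinM.
apply: le_trans (lee_wpmul2l _ (weight_series alpha_gt0)); last first.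
  by rewrite lee_fin mulr_ge0 ?(ltW gr)// ltW.
rewrite -nneseriesZl; last first.
  by move=> l _; rewrite lee_fin !mulr_ge0 ?expR_ge0// ltW// weight_gt0.
apply: lee_nneseries => l _.
  by move=> _; rewrite mule_ge0 ?measure_ge0// lee_fin (le_trans _ (bQ _))// ltW.
have [Bad [mB PB good]] := tail l.
have sub : [set w | (b l)%:E < deviation lam T (A w)]%E `<=` Bad.
  by move=> w /= bw; apply: contrapT => /good; rewrite leNgt bw.
have PS : (P [set w | (b l)%:E < deviation lam T (A w)]%E <= (2 * expR (- (2 ^ l)%:R))%:E)%E.
  apply: le_trans PB; apply: le_measure; rewrite ?inE//.
  by rewrite -[X in measurable X]setTI; exact: emeasurable_fun_o_infty.
apply: (@le_trans _ _ ((b l.+1)%:E * (2 * expR (- (2 ^ l)%:R))%:E)%E).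
  by rewrite lee_wpmul2l// lee_fin (le_trans _ (bQ _))// ltW.
rewrite -!EFinM lee_fin.
have -> : Q * (g + r) * (2 * weight alpha l.+1 * expR (- (2 ^ l)%:R)) =
  Q * ((g + r) * weight alpha l.+1) * (2 * expR (- (2 ^ l)%:R)) by ring.
rewrite ler_wpM2r ?mulr_ge0 ?expR_ge0// /b ler_wpM2l ?(ltW Q_gt0)//.
by have := ler_wpM2l g_ge0 (w1 l.+1); rewrite mulr1; lra.
Qed.

End conclusion.

Unset Implicit Arguments.

Theorem corollary1p2 (R : realType) :
  exists2 C : R, 0 < C &
  forall alpha : R, 0 < alpha -> alpha <= 2 ->
  exists2 Ca : R, 0 < Ca &
  forall (d : measure_display) (Om : measurableType d) (P : probability Om R)
    (m n : nat) (A : Om -> 'M[R]_(m, n)) (lambda K : R) (T : set 'cV[R]_n),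
    0 < lambda ->
    random_matrix A ->
    mutually_independent P (fun (j : 'I_n) w => col j (A w)) ->
    (forall i j, 'E_P[fun w => A w i j] = 0)%E ->
    (forall j, {ae P, forall w, l2norm (col j (A w)) = lambda}) ->
    (forall j, psi_normv P alpha (fun w => col j (A w)) <= K%:E)%E ->
    l2bounded T ->
    (\int[P]_w deviation lambda T (A w)
       <= (Ca * K)%R%:E * (talagrand_gamma alpha T + rad T))%E
    /\
    (forall u : R, 0 <= u ->
      ((1 - C * expR (- (u `^ alpha)))%R%:E <=
       P [set w | deviation lambda T (A w)
            <= (Ca * K)%R%:E * (talagrand_gamma alpha T + u%:E * rad T)])%E).
Proof.
have e0 : 0 < expR 1 :> R := expR_gt0 _.
have C0 : 0 < expR 1 + 2 :> R by lra.
(* With [C >= e] the tail bound is void for [u < 1]. *)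
exists (expR 1 + 2) => // alpha alpha_gt0 alpha_le2.
have Ca0 : 0 < mainC alpha by exact: mainC_gt0.
exists (mainC alpha) => // d Om P m n A lambda K T lam_gt0 mA iA meanA lamA psiA bT.
have bound1 (x : R) : ((1 - (expR 1 + 2) * expR x)%R%:E <= 1)%E.
  by rewrite lee_fin gerBl mulr_ge0 ?expR_ge0// ltW.
(* For empty [T] the deviation is [-oo], below any right-hand side. *)
have [->|/set0P[t0 Tt0]] := eqVneq T set0.
  have devN w : deviation lambda (@set0 'cV[R]_n) (A w) = -oo%E.
    by rewrite /deviation image_set0 ereal_sup0.
  split.
    rewrite (eq_integral (cst -oo%E)) => [|w _]; last exact: devN.
    rewrite integral_cst// [X in (_ * X)%E](_ : _ = 1%E) ?mule1 ?leNye//.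
    exact: probability_setT.
  move=> u u0; rewrite [X in P X](_ : _ = setT) ?probability_setT//.
  by apply/seteqP; split => // w _ /=; rewrite devN leNye.
have [r [radE r0 Tr]] := rad_finite Tt0 bT.
have dev0 w : (0 <= deviation lambda T (A w))%E by exact: deviation_ge0 Tt0.
rewrite radE; case: (posnP n) => [n0|n_gt0].
  (* Without columns nothing forces [K > 0], so the right-hand side must vanish. *)
  subst n; have T0 t : T t -> t = 0 by move=> _; rewrite [t]flatmx0.
  have r00 : r = 0.
    apply/eqP; rewrite eq_le r0 andbT -lee_fin -radE.
    by apply: ge_ereal_sup => _ [t /T0 -> <-]; rewrite l2norm0.
  have devz w : deviation lambda T (A w) = 0%E.
    by apply/eqP; rewrite eq_le dev0 andbT; exact: deviation_singleton0.
  rewrite (gamma_dim0 alpha Tt0) r00; split => [|u u0].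
    by rewrite adde0 mule0 (eq_integral (cst 0%E)) ?integral_cst ?mul0e// => w _; exact: devz.
  rewrite [X in P X](_ : _ = setT) ?probability_setT//.
  by apply/seteqP; split => // w _ /=; rewrite devz mule0 adde0 mule0.
have j0 : 'I_n := Ordinal n_gt0.
have K0 : 0 < K := psi_bound_gt0 alpha_gt0 lam_gt0 mA lamA psiA j0.
have CK0 : 0 < mainC alpha * K by exact: mulr_gt0.
(* If [gamma] is infinite, so is the right-hand side, because [mainC alpha * K] is positive. *)
have [gfin|] := ltP (talagrand_gamma alpha T) +oo%E; last first.
  rewrite leye_eq => /eqP ->; split => [|u u0].
    by rewrite addye// gt0_muley ?lte_fin// leey.
  rewrite [X in P X](_ : _ = setT) ?probability_setT//.
  apply/seteqP; split => // w _ /=.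
  by rewrite -EFinM addye// gt0_muley ?lte_fin// leey.
have g0 := talagrand_gamma_ge0 alpha Tt0.
have [Adm [g [TA Tg g_ge0 gle]]] := near_optimal Tt0 gfin.
have gE : talagrand_gamma alpha T = (fine (talagrand_gamma alpha T))%:E.
  by rewrite fineK// ge0_fin_numE.
move: g0 gle; rewrite gE; move: (fine _) => G; rewrite -EFinM !lee_fin => G0 gG.
have tail := deviation_tail alpha_gt0 alpha_le2 lam_gt0 mA iA meanA lamA psiA j0 TA Tr Tg.
have q0 := tailC_gt0 alpha_gt0; have s0 := serC_ge0 alpha; have th := root_ge1 alpha_gt0.
have Kq0 : 0 < K * tailC alpha by exact: mulr_gt0.
split => [|u u0].
  apply: le_trans (deviation_expectation alpha_gt0 mA Tt0 K0 r0 g_ge0 Tr tail) _.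
  rewrite -EFinD -EFinM lee_fin.
  have -> : mainC alpha * K * (G + r) =
    K * tailC alpha * ((2 `^ alpha^-1 + 1 + serC alpha) * (2 * (G + r))).
    by rewrite /mainC; ring.
  rewrite -mulrA ler_wpM2l ?(ltW Kq0)//; apply: ler_pM; lra.
have [u1|u1] := ltP u 1.
  apply: (@le_trans _ _ 0%E) => //; rewrite lee_fin subr_le0.
  have ua : u `^ alpha <= 1.
    have -> : (1 : R) = 1 `^ alpha by rewrite powR1.
    by apply: ge0_ler_powR; rewrite ?nnegrE// ltW.
  apply: (@le_trans _ _ ((expR 1 + 2) * expR (-1))).
    by rewrite expRN ler_pdivlMr// mul1r; lra.
  by rewrite ler_wpM2l ?(ltW C0)// ler_expR lerN2.
have := deviation_probability alpha_gt0 mA K0 r0 g_ge0 tail u1.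
move=> prob; apply: (@le_trans _ _ (1 - 2 * expR (- (u `^ alpha)))%R%:E).
  by rewrite lee_fin lerB// ler_wpM2r ?expR_ge0//; lra.
apply: le_trans prob _; apply: le_measure; rewrite ?inE.
- rewrite -[X in measurable X]setTI; apply: emeasurable_fun_infty_c => //.
  exact: measurable_deviation.
- rewrite -[X in measurable X]setTI; apply: emeasurable_fun_infty_c => //.
  exact: measurable_deviation.
move=> w /= /le_trans; apply; rewrite -(EFinM u r) -EFinD -EFinM lee_fin.
have -> : mainC alpha * K * (G + u * r) =
  K * tailC alpha * ((2 `^ alpha^-1 + 1 + serC alpha) * (2 * (G + u * r))).
  by rewrite /mainC; ring.
have ur : 0 <= u * r by exact: mulr_ge0.
rewrite -mulrA ler_wpM2l ?(ltW Kq0)//; apply: ler_pM; lra.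
Qed.
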